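(* Let $\rho_\Delta(G)=C_3(G)/\mathbb{E}_{G'\sim\mathcal{G}_{n,p}}[C_3(G')]$ and consider parameters $n,p,\varepsilon$ with $p=\Omega(\varepsilon^{-2}\cdot 1/n)$. The $(\mathcal{G}_{n,p},\rho_\Delta,\varepsilon)$-quality control problem can be solved using $O(1/p)\cdot\mathrm{poly}(\log n, 1/\varepsilon)$ adjacency matrix, adjacency list and vertex degree queries and $O(1/p)\cdot\mathrm{poly}(\log n,1/\varepsilon)$ running time, in expectation over the random choices of the algorithm. Moreover, the $(\mathcal{G}_{n,p},\rho_\Delta,\varepsilon)$-quality control problem requires $\Omega(1/p)$ queries.
   Context: Quality control with accuracy $\varepsilon$: let $\mathcal{X}$ be a set, $\rho:\mathcal{X}\to\mathbb{R}_{\ge 0}$, $\varepsilon>0$, and $\mathcal{D}$ a distribution on $\mathcal{X}$ with $\Pr_{x\sim\mathcal{D}}[|\rho(x)-1|\le\varepsilon]\ge 9/10$. A (randomized) $(\mathcal{D},\rho,\varepsilon)$-quality control algorithm $A$ must satisfy: (i) $\Pr_{x\sim\mathcal{D},R}[A(x)=\textsc{Accept}]\ge 2/3$, where $R$ is the algorithm's internal randomness; (ii) for every $x$ with $|\rho(x)-1|>\varepsilon$, $\Pr_R[A(x)=\textsc{Reject}]\ge 2/3$. Inputs are graphs on $[n]$; $C_3(G)$ is the number of triangles of $G$; $\mathcal{G}_{n,p}$ is the Erdős–Rényi distribution. Query types: adjacency matrix query $(u,v)$ returns $1$ iff $\{u,v\}$ is an edge; adjacency list query $(u,i)$ returns the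 $i$-th neighbor of $u$ in a fixed (sorted) order of its neighbors, or $\bot$ if $u$ has fewer than $i$ neighbors; degree query $u$ returns the degree of $u$.
   Formalization: The Ω(1/p) lower bound is proved for bounded ε (constant depending on the bound on ε) and when some graph must be rejected, both automatic for ε<1; for unbounded ε it is false: with p=1/2, ε≥7 every graph is acceptable and no query is needed. *)

(* Defs.v *)
From HB Require Import structures.
From mathcomp Require Import all_boot all_order all_algebra.
From mathcomp Require Import all_classical all_reals all_analysis.

Set Implicit Arguments.
Unset Strict Implicit.
Unset Printing Implicit Defensive.

Import Order.TTheory GRing.Theory Num.Theory.
Import numFieldNormedType.Exports.

Local Open Scope ring_scope.

Record sgraph (n : nat) := SGraph {
  sgraph_edges : {set 'I_n * 'I_n};
  _ : [forall u, (u, u) \notin sgraph_edges] &&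
      [forall u, forall v,
         ((u, v) \in sgraph_edges) == ((v, u) \in sgraph_edges)]
}.

HB.instance Definition _ n := [isSub for @sgraph_edges n].
HB.instance Definition _ n := [Finite of sgraph n by <:].

Definition adj n (G : sgraph n) (u v : 'I_n) : bool :=
  (u, v) \in sgraph_edges G.

(* In increasing order, since [enum 'I_n] is. *)
Definition nbrs n (G : sgraph n) (u : 'I_n) : seq 'I_n :=
  [seq v <- enum 'I_n | adj G u v].

Definition C3 n (G : sgraph n) : nat :=
  #|[set T : {set 'I_n} | (#|T| == 3) &&
      [forall u in T, forall v in T, (u != v) ==> adj G u v]]|.

Definition gnp (R : realType) n (p : R) (G : sgraph n) : R :=
  \prod_(e : 'I_n * 'I_n | (e.1 < e.2)%N)
    (if adj G e.1 e.2 then p else 1 - p).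

Definition rho_tri (R : realType) n (p : R) (G : sgraph n) : R :=
  (C3 G)%:R / \sum_(G' : sgraph n) gnp p G' * (C3 G')%:R.

(* [D] is the mass function of a distribution on the finite set [X]. *)
Definition qc_problem (R : realType) (X : finType) (D rho : X -> R) (eps : R)
    : Prop :=
  9 / 10 <= \sum_(x | `|rho x - 1| <= eps) D x.

(* [out x b] is the probability, over the internal randomness alone, that the
   algorithm outputs [b] on [x]; [true] is Accept, [false] is Reject. *)
Definition qc_solved_by (R : realType) (X : finType) (D rho : X -> R)
    (eps : R) (out : X -> bool -> R) : Prop :=
  2 / 3 <= \sum_x D x * out x true /\
  forall x, eps < `|rho x - 1| -> 2 / 3 <= out x false.

Inductive query (n : nat) :=
  | QAdj of 'I_n & 'I_n
  | QNbr of 'I_n & nat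
  | QDeg of 'I_n.

(* [QNbr u i] asks for the neighbour of [u] of rank [i], counted from 0; the
   answer is [v.+1] for a vertex [v], and 0 for "no such neighbour". *)
Definition answer n (G : sgraph n) (q : query n) : nat :=
  match q with
  | QAdj u v => adj G u v
  | QNbr u i => nth 0%N [seq (nat_of_ord v).+1 | v <- nbrs G u] i
  | QDeg u => size (nbrs G u)
  end.

(* One step of an algorithm with states in [S]; [Draw m k] draws a uniformly
   random element of {0, ..., m}. *)
Inductive action (n : nat) (S : Type) :=
  | Halt of bool
  | Tick of S
  | Ask of query n & (nat -> S)
  | Draw (m : nat) of (nat -> S).

(* An arbitrary transition system: no restriction is put on the computing
   power used between queries. *)
Record qalg (n : nat) := QAlg {
  qstate : Type;
  qinit : qstate;
  qnext : qstate -> action n qstate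
}.

Definition is_query n S (a : action n S) : bool :=
  if a is Ask _ _ then true else false.

(* Expectation, over the draws, of the total [cost] of the steps made before
   halting, plus [final b] if the output is [b]; only the first [t] steps of
   the run from [s] are taken into account. *)
Fixpoint erun (R : realType) n (A : qalg n) (G : sgraph n)
    (cost : action n (qstate A) -> R) (final : bool -> R)
    (t : nat) (s : qstate A) : R :=
  if t is t'.+1 then
    let a := qnext s in
    match a with
    | Halt b => final b
    | Tick s' => cost a + erun G cost final t' s'
    | Ask q k => cost a + erun G cost final t' (k (answer G q))
    | Draw m k =>
        cost a + m.+1%:R^-1 * \sum_(i < m.+1) erun G cost final t' (k i)
    end
  else 0.

(* The sequences below are nondecreasing in [t]. *)
Definition out_prob (R : realType) n (A : qalg n) (G : sgraph n) (b : bool)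
    : R :=
  limn (fun t => erun G (fun=> 0 : R) (fun b' => (b' == b)%:R) t (qinit A)).

Definition exp_queries (R : realType) n (A : qalg n) (G : sgraph n) : \bar R :=
  limn (fun t =>
    (erun G (fun a => (is_query a)%:R : R) (fun=> 0) t (qinit A))%:E).

Definition exp_time (R : realType) n (A : qalg n) (G : sgraph n) : \bar R :=
  limn (fun t => (erun G (fun=> 1 : R) (fun=> 1) t (qinit A))%:E).

(* Running time is measured on a word RAM with structured control flow. The
   memory is [M : nat -> nat]; every operand is a fixed address, except that
   [Fetch]/[Store] address indirectly. *)
Inductive binop := Add | Sub | Mul | Div | Mod | Lt | Eq.

Inductive cmd :=
  | Lit (d c : nat)                    (* M[d] := c *)
  | Bin (o : binop) (d a b : nat)      (* M[d] := M[a] o M[b] *)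
  | Fetch (d a : nat)                  (* M[d] := M[M[a]] *)
  | Store (a s : nat)                  (* M[M[a]] := M[s] *)
  | Rand (d a : nat)                   (* M[d] uniform in {0, ..., M[a] - 1} *)
  | AdjQ (d u v : nat)
  | NbrQ (d u i : nat)
  | DegQ (d u : nat)
  | If (a : nat) (c1 c2 : seq cmd)     (* the test is M[a] <> 0 *)
  | While (a : nat) (c : seq cmd)
  | Output (b : bool).

Definition mem := nat -> nat.

Definition eval_binop (o : binop) (x y : nat) : nat :=
  match o with
  | Add => x + y
  | Sub => x - y
  | Mul => x * y
  | Div => x %/ y
  | Mod => x %% y
  | Lt => (x < y)%N
  | Eq => x == y
  end%N.

(* Words are the integers below [W]; larger results wrap around. *)
Definition upd (W : nat) (M : mem) (d x : nat) : mem :=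
  fun i => if i == d then (x %% W)%N else M i.

(* A state is the list of commands still to be run, with the memory. A query
   about a number that is not a vertex is not sent and yields 0. *)
Definition ram_next (n W : nat) (s : seq cmd * mem)
    : action n (seq cmd * mem) :=
  let: (cs, M) := s in
  if cs is c :: k then
    match c with
    | Lit d x => Tick n (k, upd W M d x)
    | Bin o d a b => Tick n (k, upd W M d (eval_binop o (M a) (M b)))
    | Fetch d a => Tick n (k, upd W M d (M (M a)))
    | Store a x => Tick n (k, upd W M (M a) (M x))
    | Rand d a => Draw n (M a).-1 (fun x => (k, upd W M d x))
    | AdjQ d u v =>
        match insub (M u), insub (M v) with
        | Some u', Some v' => Ask (QAdj u' v') (fun x => (k, upd W M d x))
        | _, _ => Tick n (k, upd W M d 0)
        end
    | NbrQ d u i =>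
        if insub (M u) is Some u'
        then Ask (QNbr u' (M i)) (fun x => (k, upd W M d x))
        else Tick n (k, upd W M d 0)
    | DegQ d u =>
        if insub (M u) is Some u'
        then Ask (QDeg u') (fun x => (k, upd W M d x))
        else Tick n (k, upd W M d 0)
    | If a c1 c2 => Tick n ((if M a != 0%N then c1 else c2) ++ k, M)
    | While a c0 => Tick n (if M a != 0%N then c0 ++ c :: k else k, M)
    | Output b => Halt n _ b
    end
  else Halt n _ false.

(* Fixed-point value of [x >= 0] with about [f * log n] fractional bits, cut
   off at the largest word. *)
Definition fixpt (R : realType) (n W f : nat) (x : R) : nat :=
  minn W.-1 (Num.truncn (x * n%:R ^+ f)).

(* Memory is zero except for the parameters [n], [p], [eps] in cells 0, 1, 2;
   words have [K * log n] bits. *)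
Definition ram_alg (R : realType) (prog : seq cmd) (K f n : nat) (p eps : R)
    : qalg n :=
  let W := (n ^ K)%N in
  let M0 : mem := fun i =>
    match i with
    | 0 => (n %% W)%N
    | 1 => fixpt n W f p
    | 2 => fixpt n W f eps
    | _ => 0%N
    end in
  @QAlg n (seq cmd * mem)%type (prog, M0) (@ram_next n W).

(* For n < 3 the expected number of triangles, by which rho_tri divides,
   vanishes. *)
Definition in_range (R : realType) (C0 : R) (n : nat) (p eps : R) : Prop :=
  [/\ (3 <= n)%N, 0 < eps, p <= 1 & C0 * (eps ^- 2 * n%:R^-1) <= p].

(* Main.v *)
(** Lower bound. Plant a clique on one of about 1 / p disjoint blocks of O(np)
    vertices: this multiplies the number of triangles, but only answers about
    vertices of the block change. So on a graph that it accepts, the algorithm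
    must spend a constant expected number of queries in every block.

    Upper bound. Let e = min(eps, 20) and let D be a degree cap of order
    np + log n; all degrees of G(n,p) are at most D, by the exponential moment
    E[2^deg]. Draw a vertex v and two ranks below D, and test whether the two
    neighbours of v of these ranks exist and are adjacent; reject at once if
    deg v > D. A triangle with g > 0 vertices of degree at most D gets weight
    6 / g each time it is found, so it counts 12 in all, and the mean weight is
    12 (C3 - T) / (n D^2), where T counts the triangles all of whose vertices
    exceed the cap. If there are enough such vertices for T to matter, one of
    them is drawn; otherwise O(D^2 / (e^2 n^2 p^3)) samples, or O(n D^2) if the
    expected number of triangles is tiny, determine C3 within a factor
    1 +- e / 4 by Chebyshev's inequality. A random graph has
    C3 = (1 +- e / 2) E[C3], by Chebyshev's inequality if eps < 20 (then
    np >= C0 / eps^2 is large) and by Markov's inequality if eps >= 20. *)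

From HB Require Import structures.
From mathcomp Require Import all_boot all_order all_algebra.
From mathcomp Require Import all_classical all_reals all_analysis.
From mathcomp Require Import zify ring lra.
Require Import Defs.

Set Implicit Arguments.
Unset Strict Implicit.
Unset Printing Implicit Defensive.

Import Order.TTheory GRing.Theory Num.Theory.
Import numFieldNormedType.Exports.

Local Open Scope ring_scope.

(** * Runs of query algorithms *)

(** Acceptance is only needed on average over random graphs, but rejection is needed on every bad
    graph, also on one whose triangles sit at a few vertices of huge degree. Either such vertices
    are at least 2n/s in number, [s] being the number of samples, and one is probably drawn, or the
    cube of 2n/s already bounds T by e/100 times the mean [mu].

    The test accepts within 3/4 e of [mu], between the e/2 that random graphs obey and the e that
    bad graphs violate. Rounding moves these edges only within 7/10 e and 4/5 e, which leaves e/5 on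
    each side for the sampling error.

    The cap 20 on e is tied to the failure probability: at e = 20 the upper edge for random graphs
    is 11 [mu], and Markov's inequality gives 1/11, below 1/10. Below the cap, C0 = 10000 gives np
    >= 25. Hence m = e^2 (np)^3 can be below 1 only at e = 20. There the relative error of the
    rounded p is not controlled, but every graph that has to be accepted is triangle-free.

    A sample is at most 6, so its variance is at most 6 times its mean; this keeps the number of
    samples of order n D^2 / (1 + m). *)

Section Runs.
Variables (R : realType) (n : nat) (A : qalg n).
Implicit Types (G : sgraph n) (cost : action n (qstate A) -> R).
Implicit Types (final : bool -> R) (s : qstate A).

Lemma avg_le m (F F' : 'I_m.+1 -> R) : (forall i, F i <= F' i) ->
  m.+1%:R^-1 * \sum_(i < m.+1) F i <= m.+1%:R^-1 * \sum_(i < m.+1) F' i.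
Proof.
move=> h; rewrite ler_wpM2l ?invr_ge0 ?ler0n //.
by apply: ler_sum => i _; apply: h.
Qed.

Lemma avg_cst m (c : R) : m.+1%:R^-1 * \sum_(i < m.+1) c = c.
Proof. by rewrite sumr_const card_ord -[X in _ * X]mulr_natr mulrC mulfK // pnatr_eq0. Qed.

Lemma erun_ge0 G cost final t s : (forall a, 0 <= cost a) ->
  (forall b, 0 <= final b) -> 0 <= erun G cost final t s.
Proof.
move=> c0 f0; elim: t s => [//|t IH] s /=.
case: (qnext s) => [b|s'|q k|m k] //; rewrite addr_ge0 //.
by rewrite mulr_ge0 ?invr_ge0 ?ler0n ?sumr_ge0.
Qed.

Lemma erun_le G cost cost' final final' t s : (forall a, cost a <= cost' a) ->
  (forall b, final b <= final' b) ->
  erun G cost final t s <= erun G cost' final' t s.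
Proof.
move=> c0 f0; elim: t s => [//|t IH] s /=.
case: (qnext s) => [b|s'|q k|m k] //; rewrite lerD // ?c0 //.
exact: avg_le.
Qed.

Lemma erun_nondecreasing G cost final s : (forall a, 0 <= cost a) ->
  (forall b, 0 <= final b) ->
  nondecreasing_seq (fun t => erun G cost final t s).
Proof.
move=> c0 f0; apply/nondecreasing_seqP => t.
elim: t s => [|t IH] s; first exact: erun_ge0.
rewrite [leLHS]/= [leRHS]/=.
case: (qnext s) => [b|s'|q k|m k] //; rewrite lerD2l //; exact: avg_le.
Qed.

Lemma erunD G cost cost' final final' t s :
  erun G (fun a => cost a + cost' a) (fun b => final b + final' b) t s =
  erun G cost final t s + erun G cost' final' t s.
Proof.
elim: t s => [|t IH] s /=; first by rewrite addr0.
case: (qnext s) => [b|s'|q k|m k] //; rewrite ?IH; try by rewrite addrACA.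
rewrite [RHS]addrACA; congr (_ + _); rewrite -mulrDr -big_split /=.
by congr (_ * _); apply: eq_bigr => i _; rewrite IH.
Qed.

Lemma erun0 G t s : erun G (fun=> 0 : R) (fun=> 0) t s = 0.
Proof.
elim: t s => [//|t IH] s /=; case: (qnext s) => [b|s'|q k|m k] //.
- by rewrite IH addr0.
- by rewrite IH addr0.
- by rewrite big1 ?mulr0 ?addr0.
Qed.

Lemma erun_sum G (I : finType) (cost : I -> action n (qstate A) -> R) t s :
  erun G (fun a => \sum_i cost i a) (fun=> 0) t s =
  \sum_i erun G (cost i) (fun=> 0) t s.
Proof.
elim: (index_enum I) => [|i r IH].
  rewrite big_nil -[RHS](erun0 G t s); congr erun; apply/funext => a.
  by rewrite big_nil.
rewrite big_cons -IH -erunD; congr erun; apply/funext => a.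
  by rewrite big_cons.
by rewrite addr0.
Qed.

Lemma erun_le1 G final t s : (forall b, final b <= 1) ->
  erun G (fun=> 0) final t s <= 1.
Proof.
move=> f1; elim: t s => [//|t IH] s /=.
case: (qnext s) => [b|s'|q k|m k] //; rewrite add0r //.
by rewrite (le_trans (avg_le (fun i => IH _))) // avg_cst.
Qed.

Local Notation erun_out G b :=
  (fun t => erun G (fun=> 0 : R) (fun b' => (b' == b)%:R) t (qinit A)).

Lemma erun_out_cvg G b : cvgn (erun_out G b).
Proof.
apply: nondecreasing_is_cvgn.
  by apply: erun_nondecreasing => // b'; rewrite ler0n.
by exists 1 => _ [t _ <-]; apply: erun_le1 => b'; rewrite lern1 leq_b1.
Qed.

Lemma erun_le_out_prob G b t : erun_out G b t <= out_prob R A G b.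
Proof.
apply: (nondecreasing_cvgn_le (u_ := erun_out G b)); last exact: erun_out_cvg.
by apply: erun_nondecreasing => // b'; rewrite ler0n.
Qed.

(** Only an inequality, because an algorithm may run forever with positive probability. It holds
    after any number of steps and passes to the limit. *)
Lemma out_prob_sum_le1 G : out_prob R A G true + out_prob R A G false <= 1.
Proof.
rewrite /out_prob -limD; try exact: erun_out_cvg.
apply: limr_le; first by apply: is_cvgD; apply: erun_out_cvg.
apply: nearW => t; rewrite /= -[X in X <= _]erunD.
rewrite (_ : (fun _ => 0 + 0) = fun=> 0); last by apply/funext => ?; rewrite addr0.
by apply: erun_le1 => -[] /=; rewrite ?addr0 ?add0r.
Qed.

(* Until a query in [S] is made, the runs on [G] and [G'] are identical. *)
Lemma erun_coupling G G' final (S : pred (query n)) t s :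
  (forall b, 0 <= final b <= 1) ->
  (forall q, ~~ S q -> answer G q = answer G' q) ->
  erun G (fun=> 0) final t s <= erun G' (fun=> 0) final t s +
    erun G (fun a => if a is Ask q _ then (S q)%:R else 0) (fun=> 0) t s.
Proof.
move=> f01 hS; elim: t s => [|t IH] s /=; first by rewrite addr0.
case: (qnext s) => [b|s'|q k|m k] //; rewrite ?add0r ?addr0 //.
(* A query in [S] adds 1 to the right-hand side, which already exceeds any value of the left one;
   the runs need not be compared afterwards. *)
- case: (boolP (S q)) => [Sq|/hS ->]; last by rewrite add0r.
  rewrite addrA addrAC -[leLHS]add0r lerD //.
    apply: addr_ge0; apply: erun_ge0 => //; last by case=> // *; rewrite ler0n.
    by move=> b; have /andP[] := f01 b.
  by apply: erun_le1 => b; have /andP[] := f01 b.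
- by rewrite -mulrDr -big_split; exact: avg_le.
Qed.

End Runs.

(** * Moments of the random graph *)

Section Graphs.
Variable n : nat.
Implicit Types (G : sgraph n) (u v w : 'I_n).

Lemma adj_irr G u : adj G u u = false.
Proof. by case: G => E EP; apply/negbTE; case/andP: (EP) => /forallP/(_ u). Qed.

Lemma adj_sym G u v : adj G u v = adj G v u.
Proof. by case: G => E EP; apply/eqP; case/andP: (EP) => _ /forallP/(_ u)/forallP/(_ v). Qed.

(** Only the values of [r] at increasing pairs count, so every relation yields a graph. *)
Definition sym_edges (r : rel 'I_n) : {set 'I_n * 'I_n} :=
  [set e : 'I_n * 'I_n | (e.1 < e.2)%N && r e.1 e.2 || (e.2 < e.1)%N && r e.2 e.1].

Lemma sym_edgesP r : [forall u, (u, u) \notin sym_edges r] &&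
  [forall u, forall v, ((u, v) \in sym_edges r) == ((v, u) \in sym_edges r)].
Proof.
apply/andP; split; first by apply/forallP => u; rewrite inE /= ltnn.
by apply/forallP => u; apply/forallP => v; rewrite !inE /= orbC.
Qed.

Definition sym_graph (r : rel 'I_n) : sgraph n := SGraph (sym_edgesP r).

Lemma adj_sym_graph r u v : adj (sym_graph r) u v =
  (u < v)%N && r u v || (v < u)%N && r v u.
Proof. by rewrite /adj inE. Qed.

Lemma sgraph_eqP G G' : (forall u v, adj G u v = adj G' u v) -> G = G'.
Proof. by move=> h; apply: val_inj; apply/setP => -[u v]; apply: h. Qed.

Definition edges_of (T : {set 'I_n}) : {set 'I_n * 'I_n} :=
  [set e : 'I_n * 'I_n | [&& (e.1 < e.2)%N, e.1 \in T & e.2 \in T]].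

(** [T] times [T] splits into increasing pairs, decreasing pairs and the diagonal, so
    [t ^ 2 = 2 y + t] for [y] edges. *)
Lemma card_edges_of T : #|edges_of T| = 'C(#|T|, 2).
Proof.
have h : #|edges_of T| = (\sum_(u in T) \sum_(v in T) (u < v))%N.
  rewrite pair_big_dep /= -sum1_card big_mkcond [RHS]big_mkcond /=.
  by apply: eq_bigr => -[u v] _; rewrite inE /=; case: (u < v)%N; case: (u \in T); case: (v \in T).
have h2 : (#|T| * #|T| = #|edges_of T| + #|edges_of T| + #|T|)%N.
  rewrite [X in (_ + X + _)%N]h exchange_big /= h -!sum1_card big_distrlr /=.
  rewrite -!big_split /=; apply: eq_bigr => u uT.
  rewrite -[1%N in RHS](_ : \sum_(v in T) (u == v) = 1)%N; last first.
    rewrite (bigD1 u) //= eqxx big1 // => v /andP[_ /negbTE].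
    by rewrite eq_sym => ->.
  rewrite -!big_split /=; apply: eq_bigr => v _.
  by rewrite -(inj_eq val_inj) /=; case: ltngtP.
rewrite bin2; move: #|T| #|edges_of T| h2 {h} => t y h2.
by rewrite (_ : t * t.-1 = y.*2)%N ?doubleK //; case: t h2 => [|t] /=; lia.
Qed.

Lemma edges_ofI T T' : edges_of T :&: edges_of T' = edges_of (T :&: T').
Proof.
apply/setP => -[u v]; rewrite !inE /=; case: (u < v)%N => //=.
by case: (u \in T); case: (v \in T); rewrite ?andbF.
Qed.

(** A clique of any size; cardinality 3 is imposed where it is used. *)
Definition triangle G (T : {set 'I_n}) : bool :=
  [forall u in T, forall v in T, (u != v) ==> adj G u v].

Lemma triangle_edges G T :
  triangle G T = [forall e in edges_of T, adj G e.1 e.2].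
Proof.
apply/idP/idP.
  move=> /forall_inP h; apply/forall_inP => -[u v]; rewrite inE /= => /and3P[uv uT vT].
  move/forall_inP: (h u uT) => /(_ v vT) /implyP; apply.
  by rewrite -(inj_eq val_inj) /= neq_ltn uv.
move=> /forall_inP h; apply/forall_inP => u uT; apply/forall_inP => v vT.
apply/implyP; rewrite -(inj_eq val_inj) /= neq_ltn => /orP[] uv.
  by apply: (h (u, v)); rewrite inE /= uv uT.
by rewrite adj_sym; apply: (h (v, u)); rewrite inE /= uv uT vT.
Qed.

Lemma C3_triangles G : C3 G = (\sum_(T : {set 'I_n} | #|T| == 3) triangle G T)%N.
Proof.
rewrite /C3 -sum1_card big_mkcond [RHS]big_mkcond /=; apply: eq_bigr => T _.
by rewrite inE -/(triangle G T); case: eqP => _ //=; case: triangle.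
Qed.

End Graphs.

Section Gnp.
Variables (R : realType) (n : nat) (p : R).
Implicit Types (G : sgraph n) (X Y : sgraph n -> R).

(** Graphs correspond to Boolean functions on the increasing pairs, so this is distributivity; it
    carries the independence of the edges. *)
Lemma sum_sgraph_prod (F : 'I_n * 'I_n -> bool -> R) :
  \sum_(G : sgraph n) \prod_(e : 'I_n * 'I_n | (e.1 < e.2)%N) F e (adj G e.1 e.2)
  = \prod_(e : 'I_n * 'I_n | (e.1 < e.2)%N) (F e true + F e false).
Proof.
pose lt (e : 'I_n * 'I_n) := (e.1 < e.2)%N.
transitivity (\prod_(e | lt e) \sum_(b : bool | predT b) F e b); last first.
  by apply: eq_bigr => e _; rewrite big_bool.
(* Functions take the default value [false] off the increasing pairs, so that each graph comes from
   exactly one of them. *)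
rewrite (big_distr_big_dep false).
pose h (f : {ffun 'I_n * 'I_n -> bool}) := sym_graph (fun u v => f (u, v)).
pose h' G := [ffun e : 'I_n * 'I_n => lt e && adj G e.1 e.2].
have adjh f (u v : 'I_n) : (u < v)%N -> adj (h f) u v = f (u, v).
  by move=> uv; rewrite adj_sym_graph uv ltnNge ltnW //= orbF.
rewrite (reindex_onto h h') /=; last first.
  move=> G _; apply: sgraph_eqP => u v; rewrite adj_sym_graph !ffunE /lt /=.
  rewrite [adj G v u]adj_sym.
  by case: (ltngtP u v) => /= [_|_|/ord_inj ->]; rewrite ?orbF ?adj_irr.
apply: eq_big => [f|f _].
  apply/eqP/pfamilyP => [fE|[sf _]].
    split=> //; apply/fintype.subsetP => e; rewrite inE -fE ffunE [e \in lt]unfold_in.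
    by rewrite -/(lt e); case: (lt e).
  apply/ffunP => e; rewrite ffunE; case: (boolP (lt e)) => le /=.
    by rewrite adjh // -surjective_pairing.
  apply/esym/negbTE; apply: contra le => fe.
  by move/fintype.subsetP/(_ e): sf; rewrite inE fe; apply.
by apply: eq_bigr => e le; rewrite adjh // -surjective_pairing.
Qed.

Lemma Egnp_prod (phi : 'I_n * 'I_n -> bool -> R) :
  \sum_(G : sgraph n) gnp p G *
    \prod_(e : 'I_n * 'I_n | (e.1 < e.2)%N) phi e (adj G e.1 e.2)
  = \prod_(e : 'I_n * 'I_n | (e.1 < e.2)%N)
      (p * phi e true + (1 - p) * phi e false).
Proof.
rewrite -(sum_sgraph_prod (fun e b => (if b then p else 1 - p) * phi e b)).
by apply: eq_bigr => G _; rewrite /gnp -big_split.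
Qed.

Lemma gnp_sum1 : \sum_(G : sgraph n) gnp p G = 1.
Proof.
have := Egnp_prod (fun _ _ => 1).
rewrite [RHS]big1 => [<-|e _]; last by rewrite !mulr1 addrC subrK.
by apply: eq_bigr => G _; rewrite big1_eq mulr1.
Qed.

Lemma Egnp_edges (F : {set 'I_n * 'I_n}) :
  (forall e, e \in F -> (e.1 < e.2)%N) ->
  \sum_(G : sgraph n) gnp p G * [forall e in F, adj G e.1 e.2]%:R = p ^+ #|F|.
Proof.
move=> hF; pose phi e (b : bool) := if e \in F then b%:R else 1 : R.
transitivity (\sum_(G : sgraph n) gnp p G *
    \prod_(e : 'I_n * 'I_n | (e.1 < e.2)%N) phi e (adj G e.1 e.2)).
  apply: eq_bigr => G _; congr (_ * _); rewrite /phi.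
  case: (boolP [forall e in F, _]) => [/forall_inP h|].
    by rewrite big1 // => e _; case: ifP => // /h ->.
  rewrite negb_forall => /existsP[e]; rewrite negb_imply => /andP[eF ne].
  by rewrite (bigD1 e) ?hF //= eF (negbTE ne) mul0r.
rewrite Egnp_prod -prodr_const big_mkcond [RHS]big_mkcond /=.
apply: eq_bigr => e _; rewrite /phi; have := hF e; case: (e \in F) => [->|_] //.
  by rewrite mulr0 addr0 mulr1.
by case: ifP => // _; rewrite !mulr1 addrC subrK.
Qed.

Lemma Egnp_triangle T :
  \sum_(G : sgraph n) gnp p G * (triangle G T)%:R = p ^+ 'C(#|T|, 2).
Proof.
rewrite -card_edges_of -Egnp_edges; last by move=> e; rewrite inE => /andP[].
by apply: eq_bigr => G _; rewrite triangle_edges.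
Qed.

(** The two cliques share exactly the pairs inside [T :&: T']. *)
Lemma Egnp_triangle2 T T' :
  \sum_(G : sgraph n) gnp p G * ((triangle G T)%:R * (triangle G T')%:R) =
  p ^+ ('C(#|T|, 2) + 'C(#|T'|, 2) - 'C(#|T :&: T'|, 2)).
Proof.
rewrite -!card_edges_of -edges_ofI -cardsU -Egnp_edges; last first.
  by move=> e; rewrite !inE => /orP[] /andP[].
apply: eq_bigr => G _; rewrite !triangle_edges; congr (_ * _).
rewrite -natrM mulnb; congr (_%:R); congr nat_of_bool.
apply/andP/idP => [[/forall_inP h1 /forall_inP h2]|/forall_inP h].
  by apply/forall_inP => e; rewrite inE => /orP[/h1|/h2].
by split; apply/forall_inP => e he; apply: h; rewrite inE he ?orbT.
Qed.

Lemma Egnp_C3 :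
  \sum_(G : sgraph n) gnp p G * (C3 G)%:R = 'C(n, 3)%:R * p ^+ 3.
Proof.
rewrite -[n in 'C(n, 3)]card_ord -card_draws -sum1_card natr_sum mulr_suml.
under eq_bigr => G _ do rewrite C3_triangles natr_sum mulr_sumr.
rewrite exchange_big; apply: eq_big => [T|T /eqP T3]; first by rewrite inE.
by rewrite Egnp_triangle T3 mul1r.
Qed.

(** Such a [T'] arises from [T] by exchanging one of its three elements for some vertex. *)
Lemma card_triples_meet2 (T : {set 'I_n}) : #|T| = 3 ->
  (#|[set T' : {set 'I_n} | (#|T'| == 3) && (#|T :&: T'| == 2)]| <= 3 * n)%N.
Proof.
move=> T3.
pose f (x : 'I_n * 'I_n) := x.2 |: (T :\ x.1).
apply: (@leq_trans #|f @: finset.setX T [set: 'I_n]|); last first.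
  by apply: leq_trans (leq_imset_card _ _) _; rewrite cardsX T3 cardsT card_ord.
apply: subset_leq_card; apply/fintype.subsetP => T'; rewrite inE => /andP[/eqP T'3 /eqP I2].
have : #|T :\: T'| == 1%N by rewrite cardsD T3 I2.
have : #|T' :\: T| == 1%N by rewrite cardsD T'3 finset.setIC I2.
move=> /cards1P[y Dy] /cards1P[x Dx]; apply/imsetP; exists (x, y).
  have : x \in T :\: T' by rewrite Dx inE.
  by rewrite !inE andbT => /andP[].
apply/setP => z; move/setP/(_ z): Dy; move/setP/(_ z): Dx; rewrite !inE /=.
by case: (z \in T); case: (z \in T') => //=; case: (z == x) => //; case: (z == y).
Qed.

(** Pairs of triples are sorted by their intersection: with at most one common vertex six edges are
    required, with two vertices five, which happens for at most [3 n] choices of [T'], and equal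
    triples require three. Charging [p ^ 6] to all pairs gives the squared mean. *)
Lemma Egnp_C3_sq : 0 <= p <= 1 ->
  \sum_(G : sgraph n) gnp p G * (C3 G)%:R ^+ 2 <=
  ('C(n, 3)%:R * p ^+ 3) ^+ 2 + 'C(n, 3)%:R * (p ^+ 3 + 3 * n%:R * p ^+ 5).
Proof.
move=> /andP[p0 p1].
have -> : \sum_(G : sgraph n) gnp p G * (C3 G)%:R ^+ 2 =
  \sum_(T : {set 'I_n} | #|T| == 3) \sum_(T' : {set 'I_n} | #|T'| == 3)
     p ^+ (6 - 'C(#|T :&: T'|, 2)).
  under eq_bigr => G _ do rewrite C3_triangles natr_sum expr2 big_distrlr /= mulr_sumr.
  rewrite exchange_big; apply: eq_bigr => T /eqP T3.
  under eq_bigr => G _ do rewrite mulr_sumr.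
  rewrite exchange_big; apply: eq_bigr => T' /eqP T'3.
  by rewrite Egnp_triangle2 T3 T'3.
have cn : \sum_(T : {set 'I_n} | #|T| == 3) (1 : R) = 'C(n, 3)%:R.
  rewrite -[n in RHS]card_ord -card_draws -sum1_card natr_sum.
  by apply: eq_bigl => T; rewrite inE.
have -> : ('C(n, 3)%:R * p ^+ 3) ^+ 2 + 'C(n, 3)%:R * (p ^+ 3 + 3 * n%:R * p ^+ 5) =
  \sum_(T : {set 'I_n} | #|T| == 3) ('C(n, 3)%:R * p ^+ 6 + (p ^+ 3 + 3 * n%:R * p ^+ 5)).
  by rewrite -[X in \sum_(_ | _) X]mul1r -mulr_suml cn; ring.
apply: ler_sum => T /eqP T3.
apply: (@le_trans _ _ (\sum_(T' : {set 'I_n} | #|T'| == 3)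
   (p ^+ 6 + ((T' == T)%:R * p ^+ 3 + (#|T :&: T'| == 2)%:R * p ^+ 5)))).
  apply: ler_sum => T' /eqP T'3.
  have ge0 k : 0 <= p ^+ k by rewrite exprn_ge0.
  have := subset_leq_card (subsetIl T T'); rewrite T3.
  case E: #|T :&: T'| => [|[|[|[|k]]]] // _.
  - by rewrite mul0r addr0 lerDl mulr_ge0.
  - by rewrite mul0r addr0 lerDl mulr_ge0.
  - by rewrite mul1r addrA lerDr addr_ge0 ?mulr_ge0.
  have -> : T' == T.
    rewrite eq_sym eqEcard T3 T'3 leqnn andbT; apply/finset.setIidPl/eqP.
    by rewrite eqEcard subsetIl T3 E.
  by rewrite mul1r mul0r addr0 lerDr.
rewrite !big_split /= lerD //; last first.
  rewrite lerD //.
    rewrite -mulr_suml -[leRHS]mul1r ler_wpM2r ?exprn_ge0 //.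
    rewrite (bigD1 T) ?T3 //= eqxx big1 ?addr0 // => T' /andP[_ /negbTE ->] //.
  rewrite -mulr_suml ler_wpM2r ?exprn_ge0 //.
  rewrite -natrM -natr_sum ler_nat.
  apply: leq_trans (card_triples_meet2 T3); rewrite -sum1_card.
  rewrite big_mkcond [leqRHS]big_mkcond /=; apply: leq_sum => T' _.
  by rewrite inE; case: (_ == 3) => //=; case: (_ == 2).
by rewrite -[X in \sum_(_ | _) X]mul1r -mulr_suml cn.
Qed.

Lemma gnp_ge0 G : 0 <= p <= 1 -> 0 <= gnp p G.
Proof.
move=> /andP[p0 p1]; apply: prodr_ge0 => e _.
by case: ifP => _ //; rewrite subr_ge0.
Qed.

Lemma size_nbrs G u : size (nbrs G u) = #|[set v | adj G u v]|.
Proof.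
rewrite /nbrs -sum1_size big_filter big_enum_cond -sum1_card.
by apply: eq_bigl => v; rewrite inE.
Qed.

Definition pair_of (v w : 'I_n) := if (w < v)%N then (w, v) else (v, w).

Lemma pair_of_inj v : injective (pair_of v).
Proof.
move=> w w'; rewrite /pair_of; case: ltnP => h; case: ltnP => h' [] //.
- by move=> e1 _; rewrite e1 ltnn in h.
- by move=> e1 _; rewrite -e1 ltnn in h'.
Qed.

(** [2 ^ deg] is bounded by a product of independent factors, one for each pair at [v], of mean
    [1 + p]; [pair_of v] shows that there are at most [n] of them. *)
Lemma Egnp_exp2_deg v : 0 <= p <= 1 ->
  \sum_(G : sgraph n) gnp p G * 2 ^+ size (nbrs G v) <= (1 + p) ^+ n.
Proof.
move=> p01; have /andP[p0 p1] := p01.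
pose phi e (b : bool) := if b && ((e.1 == v) || (e.2 == v)) then 2 else 1 : R.
apply: (@le_trans _ _ (\sum_(G : sgraph n) gnp p G *
    \prod_(e : 'I_n * 'I_n | (e.1 < e.2)%N) phi e (adj G e.1 e.2))).
  apply: ler_sum => G _; apply: ler_wpM2l; first exact: gnp_ge0.
  rewrite /phi -big_mkcondr /= prodr_const size_nbrs ler_weXn2l ?ler1n //.
  rewrite -(card_imset _ (@pair_of_inj v)) -[leqRHS]cardsE; apply: subset_leq_card.
  apply/fintype.subsetP => e /imsetP[w]; rewrite inE => vw ->; rewrite inE unfold_in /pair_of.
  have neq : (v != w :> nat).
    by apply/eqP => /val_inj e'; rewrite e' adj_irr in vw.
  case: (ltnP w v) => h /=; first by rewrite h adj_sym vw eqxx orbT.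
  by rewrite ltn_neqAle neq h vw eqxx.
rewrite Egnp_prod /phi /=.
apply: (@le_trans _ _ (\prod_(e in [set pair_of v w | w in 'I_n]) (1 + p))).
  rewrite big_mkcond [leRHS]big_mkcond; apply: ler_prod => e _.
  case: (boolP (e \in _)) => he.
    by case: ifP => _; [case: ifP => _|]; lra.
  case: (boolP (_ < _)%N) => le /=; last by rewrite ler01 lexx.
  suff /negbTE -> : ~~ ((e.1 == v) || (e.2 == v)) by lra.
  apply: contra he; case: e le => a b /= ab /orP[] /eqP E; apply/imsetP.
    by exists b => //; rewrite /pair_of -E ltnNge (ltnW ab).
  by exists a => //; rewrite /pair_of -E ab.
rewrite prodr_const ler_weXn2l ?lerDl //.
by apply: leq_trans (leq_imset_card _ _) _; rewrite card_ord.
Qed.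

(** Markov's inequality for [2 ^ deg], and a union bound over the vertices. *)
Lemma gnp_max_degree D : 0 <= p <= 1 ->
  \sum_(G : sgraph n | [exists v, (D < size (nbrs G v))%N]) gnp p G <=
  n%:R * (1 + p) ^+ n / 2 ^+ D.
Proof.
move=> p01; have D0 : (0 : R) < 2 ^+ D by rewrite exprn_gt0.
rewrite ler_pdivlMr // mulr_suml.
apply: (@le_trans _ _ (\sum_(v : 'I_n) \sum_(G : sgraph n) gnp p G * 2 ^+ size (nbrs G v))).
  rewrite exchange_big big_mkcond /=; apply: ler_sum => G _.
  have ge0 v : 0 <= gnp p G * 2 ^+ size (nbrs G v).
    by rewrite mulr_ge0 ?gnp_ge0 // exprn_ge0.
  case: ifP => [/existsP[v hv]|_]; last exact: sumr_ge0.
  rewrite (bigD1 v) //= -[leLHS]addr0 lerD ?sumr_ge0 //.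
  by rewrite ler_wpM2l ?gnp_ge0 // ler_weXn2l ?ler1n // ltnW.
apply: (@le_trans _ _ (\sum_(v : 'I_n) (1 + p) ^+ n)).
  by apply: ler_sum => v _; apply: Egnp_exp2_deg.
by rewrite sumr_const card_ord mulr_natl.
Qed.

End Gnp.

(** * The lower bound *)

Section LowerBound.
Variable R : realType.

Lemma erun_le_exp_queries n (A : qalg n) (G : sgraph n) t :
  ((erun G (fun a => (is_query a)%:R : R) (fun=> 0) t (qinit A))%:E
     <= exp_queries R A G)%E.
Proof.
have nd : nondecreasing_seq (fun t =>
    (erun G (fun a => (is_query a)%:R : R) (fun=> 0) t (qinit A))%:E).
  by move=> t1 t2 t12; rewrite lee_fin; apply: erun_nondecreasing t12.
rewrite /exp_queries (cvg_lim _ (ereal_nondecreasing_cvgn nd)) //.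
by apply: ereal_sup_ubound; exists t.
Qed.

(** By the coupling, a drop of the acceptance probability from [G] to [H j] is paid for by queries
    in [S j]; the classes are disjoint, so these costs add up. At a finite time the acceptance on
    [G] already exceeds 1/2, hence [1 / 2 - 1 / 3 = 1 / 6] for each class. *)
Lemma exp_queries_disjoint n (A : qalg n) (G : sgraph n) (J : finType)
    (S : J -> pred (query n)) (H : J -> sgraph n) :
  (forall j q, ~~ S j q -> answer G q = answer (H j) q) ->
  (forall q, (\sum_j S j q <= 1)%N) ->
  2 / 3 <= out_prob R A G true -> (forall j, out_prob R A (H j) true <= 1 / 3) ->
  ((#|J|%:R / 6)%:E <= exp_queries R A G)%E.
Proof.
move=> agree disj outG outH.
pose u t := erun G (fun=> 0 : R) (fun b' => (b' == true)%:R) t (qinit A).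
have cu : (u @ \oo --> out_prob R A G true)%classic by exact: erun_out_cvg.
have [t ut] : exists t, 1 / 2 < u t.
  have h : 1 / 2 < out_prob R A G true by lra.
  by have [t _ /(_ t (leqnn t)) ?] := cvgr_gt _ cu _ h; exists t.
apply: le_trans (erun_le_exp_queries A G t); rewrite lee_fin.
pose touch j (a : action n (qstate A)) : R := if a is Ask q _ then (S j q)%:R else 0.
apply: (@le_trans _ _ (\sum_j erun G (touch j) (fun=> 0) t (qinit A))).
  rewrite -sum1_card natr_sum mulr_suml.
  apply: ler_sum => j _.
  have := @erun_coupling R n A G (H j) (fun b => (b == true)%:R) (S j) t (qinit A).
  rewrite -/(u t) => /(_ _ (agree j)) h.
  have {}h := h (fun b => ltac:(by rewrite ler0n lern1 leq_b1)).
  have h2 := erun_le_out_prob R A (H j) true t; have h3 := outH j.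
  by rewrite /= in h h2 *; rewrite /touch; lra.
rewrite -erun_sum; apply: erun_le => // -[b|s'|q k|m k] /=; try by rewrite big1.
by rewrite -natr_sum ler_nat.
Qed.

Lemma ltn_double_divM n s : (0 < s)%N -> (s <= n)%N -> (n < 2 * (n %/ s * s))%N.
Proof.
by move=> s0 sn; have := ltn_ceil n s0; rewrite -divn_gt0 // in sn; nia.
Qed.

Lemma bin3 n : (6 * 'C(n, 3) = n * n.-1 * n.-2)%N.
Proof. by have := bin_ffact n 3; rewrite !ffactnS ffactn0 (_ : 3`! = 6)%N // => h; lia. Qed.

(** The constant 27 is forced by [n = 3]. *)
Lemma bin3_ge n : (3 <= n)%N -> (n ^ 3 <= 27 * 'C(n, 3))%N.
Proof.
move=> n3; have := bin3 n; case: n n3 => [|[|[|n]]] // _ /=.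
by rewrite !expnS expn0; nia.
Qed.

Definition planted n (G : sgraph n) (P : pred 'I_n) : sgraph n :=
  sym_graph (fun u v => adj G u v || P u && P v).

Lemma adj_planted n (G : sgraph n) (P : pred 'I_n) u v :
  adj (planted G P) u v = (u != v) && (adj G u v || P u && P v).
Proof.
rewrite adj_sym_graph [adj G v u]adj_sym [P v && _]andbC -(inj_eq val_inj) /=.
by case: ltngtP => //=; rewrite orbF.
Qed.

Lemma C3_planted n (G : sgraph n) (P : pred 'I_n) :
  ('C(#|[set u | P u]|, 3) <= C3 (planted G P))%N.
Proof.
rewrite -cards_draws; apply: subset_leq_card; apply/fintype.subsetP => T.
rewrite !inE => /andP[/fintype.subsetP TP ->] /=.
apply/forall_inP => u uT; apply/forall_inP => v vT; apply/implyP => uv.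
have := TP u uT; have := TP v vT; rewrite !inE adj_planted uv => -> ->.
by rewrite orbT.
Qed.

(** An adjacency query is charged to its first vertex alone: planting changes a pair only if both
    ends lie in the block. *)
Definition query_vertex n (q : query n) : 'I_n :=
  match q with QAdj u _ => u | QNbr u _ => u | QDeg u => u end.

Lemma answer_planted n (G : sgraph n) (P : pred 'I_n) q :
  ~~ P (query_vertex q) -> answer G q = answer (planted G P) q.
Proof.
have E u v : ~~ P u -> adj (planted G P) u v = adj G u v.
  move=> /negbTE Pu; rewrite adj_planted Pu orbF.
  by case: (eqVneq u v) => // ->; rewrite adj_irr.
have E' u : ~~ P u -> nbrs (planted G P) u = nbrs G u.
  by move=> Pu; apply: eq_filter => v; apply: E.
by case: q => [u v|u i|u] /= Pu; rewrite ?E ?E'.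
Qed.

Lemma card_block n s j : (0 < s)%N -> (j < n %/ s)%N ->
  (s <= #|[set u : 'I_n | u %/ s == j]|)%N.
Proof.
move=> s0 jn.
have lt (i : 'I_s) : (j * s + i < n)%N.
  apply: (@leq_trans (j.+1 * s)); first by rewrite mulSn addnC ltn_add2r.
  by apply: leq_trans (leq_divM n s); rewrite leq_mul2r jn orbT.
pose f i := Ordinal (lt i).
have injf : injective f.
  by move=> i i' /(congr1 val) /= /addnI; apply: ord_inj.
rewrite -[leqLHS]card_ord -(card_imset _ injf); apply: subset_leq_card.
apply/fintype.subsetP => u /imsetP[i _ ->]; rewrite inE /=.
by rewrite divnMDl // divn_small ?addn0 // ltn_ord.
Qed.

Lemma mean_le_max (X : finType) (x0 : X) (D f : X -> R) (a : R) :
  (forall x, 0 <= D x) -> \sum_x D x = 1 -> a <= \sum_x D x * f x ->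
  exists x, a <= f x.
Proof.
move=> D0 D1 h.
case: (@arg_maxP _ _ _ x0 xpredT f) => // x _ hx; exists x; apply: le_trans h _.
rewrite -[leRHS]mul1r -D1 mulr_suml; apply: ler_sum => y _.
by apply: ler_wpM2l; [apply: D0 | apply: hx].
Qed.

Lemma in_range_p_gt0 (C0 : R) n (p eps : R) : 0 < C0 ->
  in_range C0 n p eps -> 0 < p.
Proof.
move=> C00 [n3 e0 _]; apply: lt_le_trans.
by rewrite !mulr_gt0 ?invr_gt0 ?exprn_gt0 // ltr0n; lia.
Qed.

Lemma in_range_np (C0 : R) n (p eps : R) :
  in_range C0 n p eps -> C0 <= eps ^+ 2 * (n%:R * p).
Proof.
move=> [n3 e0 _ h].
have n0 : 0 < n%:R :> R by rewrite ltr0n; lia.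
have e20 : 0 < eps ^+ 2 * n%:R by rewrite mulr_gt0 ?exprn_gt0.
move: h; rewrite -(ler_pM2r e20) => h.
rewrite [leRHS]mulrA mulrC; apply: le_trans h.
by rewrite -invfM -mulrA mulVf ?mulr1 // gt_eqF.
Qed.

Lemma quality_control_lower_bound (C0 E : R) : 0 < C0 ->
  exists c : R, 0 < c /\
     forall (n : nat) (p eps : R),
       in_range C0 n p eps ->
       eps <= E ->
       (exists G : sgraph n, eps < `|rho_tri p G - 1|) ->
       forall A : qalg n,
         qc_solved_by (@gnp R n p) (@rho_tri R n p) eps (@out_prob R n A) ->
         exists G : sgraph n, ((c * p^-1)%:E <= exp_queries R A G)%E.
Proof.
move=> C00; have [E0|E0] := lerP E 0.
  by exists 1; split=> // n p eps [_ e0 _ _] eE; lra.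
(* This makes [s <= K * X] for the block size [s] below: the second summand pays for the additive 3
   in [s], because [C0 <= E ^ 2 * X]. *)
pose K := 27 * (1 + E) + 3 * E ^+ 2 / C0.
have K0 : 0 < K by rewrite /K addr_gt0 ?divr_gt0 ?mulr_gt0 ?exprn_gt0 //; lra.
exists (12 * K)^-1; split; first by rewrite invr_gt0 mulr_gt0.
move=> n p eps rng eE [G0 G0bad] A [acc rej].
have p0 := in_range_p_gt0 C00 rng; have [n3 e0 p1 pge] := rng.
have n0 : 0 < n%:R :> R by rewrite ltr0n (ltn_trans _ n3).
have p01 : 0 <= p <= 1 by rewrite p1 ltW.
have [G outG] : exists G, 2 / 3 <= out_prob R A G true.
  apply: mean_le_max acc => //; last exact: gnp_sum1.
  by move=> G; apply: gnp_ge0.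
have rejle H : eps < `|rho_tri p H - 1| -> out_prob R A H true <= 1 / 3.
  by move=> /rej; have := out_prob_sum_le1 R A H; lra.
exists G; pose X := n%:R * p.
have X0 : 0 < X by rewrite mulr_gt0.
have XE : C0 <= E ^+ 2 * X.
  by apply: le_trans (in_range_np rng) _; rewrite ler_wpM2r ?(ltW X0) // ler_sqr ?nnegrE; lra.
(* A clique on [s > 27 (1 + E) X] vertices has at least [s ^ 3 / 27] triangles, more than [(1 + E)]
   times the mean; the additive 3 makes [bin3_ge] applicable. *)
pose s := (Num.truncn (27 * (1 + E) * X)).+3.
have tr0 : 0 <= 27 * (1 + E) * X by rewrite !mulr_ge0 //; lra.
have /andP[s_le s_gt] := truncn_itv tr0.
have sK : s%:R <= K * X.
  rewrite (_ : s%:R = (Num.truncn (27 * (1 + E) * X))%:R + 3) /K; last first.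
    by rewrite -natrD addn3.
  rewrite [leRHS]mulrDl lerD //.
  by rewrite mulrAC ler_pdivlMr // ; lra.
have sgt : 27 * (1 + E) * X < s%:R.
  by apply: lt_le_trans s_gt _; rewrite ler_nat ltnW.
have cge c' : c' = (12 * K)^-1 * p^-1 -> c' = (12 * (K * p))^-1.
  by move=> ->; rewrite -invfM mulrA.
(* If no block fits, then [K * p > 1] and a constant number of queries is enough: all queries form
   one class, and [G0] is the graph to be told apart from [G]. *)
have [sn|ns] := leqP s n; last first.
  have := @exp_queries_disjoint n A G unit (fun _ _ => true) (fun=> G0).
  move=> /(_ _ _ outG) h; apply: le_trans (h _ _ _) => //; last 2 first.
  - by move=> q; rewrite (bigD1 tt) //= big1 // => -[].
  - by move=> _; apply: rejle.
  rewrite card_unit lee_fin (cge _ erefl).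
  have : n%:R < K * X by apply: lt_le_trans sK; rewrite ltr_nat.
  rewrite /X mulrCA -[ltLHS]mulr1 ltr_pM2l // => Kp.
  by clear h; rewrite mul1r lef_pV2 ?posrE //; lra.
pose m := (n %/ s)%N.
have := @exp_queries_disjoint n A G 'I_m
  (fun j q => (query_vertex q %/ s)%N == j)
  (fun j => planted G (fun u => (u %/ s)%N == j)).
move=> /(_ _ _ outG) h; apply: le_trans (h _ _ _) => //; last 3 first.
- by move=> j q; apply: answer_planted.
- move=> q; case: (ltnP (query_vertex q %/ s) m) => hq.
    rewrite (bigD1 (Ordinal hq)) //= eqxx big1 // => j /negbTE.
    by rewrite -(inj_eq val_inj) /= eq_sym => ->.
  by rewrite big1 // => j _; rewrite gtn_eqF // (leq_trans (ltn_ord j)).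
- move=> j; apply: rejle.
  set H := planted _ _.
  have s_C : ('C(s, 3) <= C3 H)%N.
    apply: leq_trans (C3_planted _ _); rewrite leq_bin2l //.
    by apply: card_block.
  have mu0 : 0 < 'C(n, 3)%:R * p ^+ 3 by rewrite mulr_gt0 ?exprn_gt0 // ltr0n bin_gt0.
  have : (1 + E) * ('C(n, 3)%:R * p ^+ 3) < (C3 H)%:R.
    apply: (@lt_le_trans _ _ ('C(s, 3)%:R)); last by rewrite ler_nat.
    have h1 : s%:R ^+ 3 <= 27 * 'C(s, 3)%:R :> R.
      by rewrite -natrX -natrM ler_nat bin3_ge.
    have h2 : 6 * 'C(n, 3)%:R <= n%:R ^+ 3 :> R.
      rewrite -natrX -natrM ler_nat bin3 !expnS expn0 muln1 mulnA.
      by rewrite !leq_mul // ?leq_pred // (leq_trans (leq_pred _)) ?leq_pred.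
    have h3 : 27 * (1 + E) * X ^+ 3 < s%:R ^+ 3.
      apply: (@le_lt_trans _ _ ((27 * (1 + E) * X) ^+ 3)).
        rewrite [leRHS]exprMn ler_wpM2r ?exprn_ge0 ?(ltW X0) //.
        by rewrite ler_eXnr //; lra.
      by rewrite ltrXn2r //; lra.
    have h4 : 6 * ((1 + E) * ('C(n, 3)%:R * p ^+ 3)) <= (1 + E) * X ^+ 3.
      rewrite mulrCA ler_wpM2l //; first by lra.
      by rewrite mulrA /X exprMn ler_wpM2r ?exprn_ge0 // ltW.
    have : 0 <= (1 + E) * X ^+ 3 by rewrite mulr_ge0 ?exprn_ge0 //; lra.
    by lra.
  rewrite -ltr_pdivlMr // => hC.
  rewrite /rho_tri Egnp_C3 ltr_normr; apply/orP; left.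
  by lra.
rewrite card_ord lee_fin (cge _ erefl).
(* More than half of the vertices lie in full blocks, so there are more than [1 / (2 K p)]
   blocks. *)
have ms := ltn_double_divM (isT : 0 < s)%N sn.
have {}ms : n%:R < 2 * (m%:R * (K * X)).
  apply: (@lt_le_trans _ _ (2 * (m%:R * s%:R))).
    by rewrite -!natrM ltr_nat.
  by rewrite ler_pM2l // ler_wpM2l.
move: ms; rewrite /X.
have -> : 2 * (m%:R * (K * (n%:R * p))) = n%:R * (2 * m%:R * (K * p)) by ring.
rewrite -[ltLHS]mulr1 ltr_pM2l // => ms.
have Kp : 0 < K * p by rewrite mulr_gt0.
by rewrite invfM -[leRHS](mulfK (lt0r_neq0 Kp)) ler_wpM2r ?invr_ge0 ?ltW //; lra.
Qed.

End LowerBound.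

(** * Sampling triangles *)

Section TriangleCount.
Variables (n : nat) (G : sgraph n).
Implicit Types (u v w : 'I_n) (T : {set 'I_n}).

Definition closed3 v u w : bool := [&& adj G v u, adj G v w & adj G u w].

Lemma closed3_rot v u w : closed3 u w v = closed3 v u w.
Proof. by rewrite /closed3 [adj G u v]adj_sym [adj G w v]adj_sym andbC andbA. Qed.

(** The only candidate for [T] is [[set v; u; w]]; the successive removals force the three vertices
    to be distinct. *)
Lemma closed3_sets v u w :
  (\sum_(T : {set 'I_n} | [&& #|T| == 3, triangle G T, v \in T, u \in T :\ v
              & w \in T :\ v :\ u]) 1)%N = closed3 v u w.
Proof.
have tri T : triangle G T -> v \in T -> u \in T :\ v -> w \in T :\ v :\ u ->
    closed3 v u w.
  move=> /forall_inP h vT; rewrite !inE => /andP[uv uT] /and3P[wu wv wT].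
  have {}h x y : x \in T -> y \in T -> x != y -> adj G x y.
    by move=> xT yT xy; move/forall_inP: (h x xT) => /(_ y yT)/implyP; apply.
  by rewrite /closed3 !h // eq_sym.
case: (boolP (closed3 v u w)) => [cl|ncl]; last first.
  rewrite big_pred0 // => T; apply/negP => /and5P[_ h1 h2 h3 h4].
  by case/negP: ncl; apply: tri h1 h2 h3 h4.
have /and3P[vu vw uw] := cl.
have ne x y : adj G x y -> x != y.
  by apply: contraTneq => ->; rewrite adj_irr.
have /negbTE nvu := ne _ _ vu; have /negbTE nvw := ne _ _ vw.
have /negbTE nuw := ne _ _ uw.
pose T0 := [set v; u; w].
have T03 : #|T0| = 3.
  rewrite /T0 [_ :|: [set w]]finset.setUC cardsU1 !inE cards2 nvu.
  by rewrite [w == v]eq_sym [w == u]eq_sym nvw nuw.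
rewrite (big_pred1 T0) // => T; apply/idP/idP.
  move=> /and5P[/eqP T3 _ vT]; rewrite !inE => /andP[_ uT] /and3P[_ _ wT].
  rewrite /= eq_sym eqEcard T3 T03 leqnn andbT; apply/fintype.subsetP => x.
  by rewrite !inE => /orP[/orP[]|] /eqP ->.
move=> /eqP ->; rewrite T03 eqxx !inE !eqxx /=.
rewrite [w == v]eq_sym [w == u]eq_sym [u == v]eq_sym nvu nvw nuw ?orbT /= andbT.
apply/forall_inP => x; rewrite !inE => hx; apply/forall_inP => y; rewrite !inE.
move=> hy; apply/implyP; move: hx hy => /orP[/orP[]|] /eqP -> /orP[/orP[]|] /eqP ->;
  by rewrite ?eqxx // adj_sym.
Qed.

Lemma sum_closed3 : (\sum_v \sum_u \sum_w closed3 v u w = 6 * C3 G)%N.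
Proof.
pose P (T : {set 'I_n}) := (#|T| == 3) && triangle G T.
pose Q v u w T := [&& v \in T, u \in T :\ v & w \in T :\ v :\ u] : nat.
have -> : C3 G = (\sum_(T | P T) 1)%N.
  by rewrite /C3 -sum1_card; apply: eq_bigl => T; rewrite inE.
rewrite big_distrr /= muln1.
transitivity (\sum_v \sum_u \sum_w \sum_(T | P T) Q v u w T)%N.
  apply: eq_bigr => v _; apply: eq_bigr => u _; apply: eq_bigr => w _.
  rewrite -closed3_sets big_mkcond [RHS]big_mkcond; apply: eq_bigr => T _.
  by rewrite /P /Q; case: (_ == 3) => //=; case: triangle => //=; case: [&& _, _ & _].
transitivity (\sum_v \sum_u \sum_(T | P T) \sum_w Q v u w T)%N.
  by apply: eq_bigr => v _; apply: eq_bigr => u _; rewrite exchange_big.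
transitivity (\sum_v \sum_(T | P T) \sum_u \sum_w Q v u w T)%N.
  by apply: eq_bigr => v _; rewrite exchange_big.
rewrite exchange_big /=; apply: eq_bigr => T /andP[T3 tT].
transitivity (\sum_(v in T) \sum_(u in T :\ v) \sum_(w in T :\ v :\ u) 1)%N.
  rewrite [RHS]big_mkcond; apply: eq_bigr => v _.
  case: ifP => vT; last first.
    by rewrite big1 // => u _; rewrite big1 // => w _; rewrite /Q vT.
  rewrite [RHS]big_mkcond; apply: eq_bigr => u _.
  case: ifP => uT; last by rewrite big1 // => w _; rewrite /Q uT andbF.
  by rewrite [RHS]big_mkcond; apply: eq_bigr => w _; rewrite /Q vT uT; case: (w \in _).
transitivity (\sum_(v in T) 2)%N; last by rewrite sum_nat_const (eqP T3).
apply: eq_bigr => v vT; have c2 : #|T :\ v| = 2.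
  by have := cardsD1 v T; rewrite vT (eqP T3) => -[].
transitivity (\sum_(u in T :\ v) 1)%N; last by rewrite sum1_card c2.
apply: eq_bigr => u uT; rewrite sum1_card.
by have := cardsD1 u (T :\ v); rewrite uT c2 => -[].
Qed.

Variable D : nat.

Definition heavy v : bool := (D < size (nbrs G v))%N.

Definition heavy_set : {set 'I_n} := [set v | heavy v].

(** When the first vertex of a triangle is light, [3 - heavy u - heavy w] is its number of light
    vertices, and it divides 6. *)
Definition hit u w : nat := (adj G u w * (6 %/ (3 - heavy u - heavy w)))%N.

(* A triangle is found from each of its [g] light vertices, in two orders; the
   weight [6 / g] makes it count 12 in all, unless it has no light vertex. *)
Lemma sum_hits : exists2 H,
  (\sum_(v | ~~ heavy v) \sum_(u | adj G v u) \sum_(w | adj G v w) hit u w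
    + 2 * H = 12 * C3 G)%N & (H <= #|heavy_set| ^ 3)%N.
Proof.
(* This counts each triangle with three heavy vertices once per ordering, so it is [6 T]. *)
exists (\sum_v \sum_u \sum_w closed3 v u w * [&& heavy v, heavy u & heavy w])%N;
  last first.
  apply: (@leq_trans (\sum_(v in heavy_set) \sum_(u in heavy_set)
     \sum_(w in heavy_set) 1)%N); last first.
    by rewrite sum1_card !sum_nat_const !expnS expn0 muln1.
  rewrite [leqRHS]big_mkcond; apply: leq_sum => v _; rewrite inE; case: (heavy v); last first.
    by rewrite big1 // => u _; rewrite big1 // => w _; rewrite muln0.
  rewrite [leqRHS]big_mkcond; apply: leq_sum => u _; rewrite inE; case: (heavy u); last first.
    by rewrite big1 // => w _; rewrite muln0.
  rewrite [leqRHS]big_mkcond; apply: leq_sum => w _; rewrite inE.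
  by case: (heavy w); case: closed3.
pose l v := ~~ heavy v : nat.
pose F v u w := (closed3 v u w * (l v * (6 %/ (l v + l u + l w))))%N.
have -> : (\sum_(v | ~~ heavy v) \sum_(u | adj G v u) \sum_(w | adj G v w) hit u w =
   \sum_v \sum_u \sum_w F v u w)%N.
  rewrite big_mkcond; apply: eq_bigr => v _; rewrite /F /l /closed3 /hit.
  case: (heavy v) => /=.
    by rewrite big1 // => u _; rewrite big1 // => w _; rewrite mul0n muln0.
  rewrite big_mkcond; apply: eq_bigr => u _; case: (adj G v u) => /=; last first.
    by rewrite big1.
  rewrite big_mkcond; apply: eq_bigr => w _; case: (adj G v w) => //=.
  by rewrite mul1n; case: (heavy u); case: (heavy w).
(* The weight of an ordered triple depends on which vertex comes first, but the weights of its three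
   rotations add up to 6 unless all vertices are heavy. After tripling, the identity therefore holds
   term by term. *)
have r1 : (\sum_v \sum_u \sum_w F v u w = \sum_v \sum_u \sum_w F u w v)%N.
  by rewrite [RHS]exchange_big; apply: eq_bigr => v _; rewrite [RHS]exchange_big.
have r2 : (\sum_v \sum_u \sum_w F v u w = \sum_v \sum_u \sum_w F w v u)%N.
  by under [RHS]eq_bigr => v _ do rewrite exchange_big; rewrite [RHS]exchange_big.
suff : (3 * (\sum_v \sum_u \sum_w F v u w +
  2 * \sum_v \sum_u \sum_w closed3 v u w * [&& heavy v, heavy u & heavy w])
  = 3 * (12 * C3 G))%N by move=> h; apply/eqP; rewrite -(eqn_pmul2l (m := 3)) // h.
rewrite mulnDr (_ : 3 * (12 * C3 G) = 6 * (6 * C3 G))%N ?mulnA //.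
rewrite -(mulnA 6 6) -sum_closed3.
rewrite -(_ : forall x, x + x + x = 3 * x)%N; last by move=> x; lia.
rewrite {2}r1 {2}r2 (_ : 3 * 2 = 6)%N //.
rewrite !big_distrr -!big_split /=; apply: eq_bigr => v _.
rewrite !big_distrr -!big_split /=; apply: eq_bigr => u _.
rewrite !big_distrr -!big_split /=; apply: eq_bigr => w _.
rewrite /F (closed3_rot u w v) (closed3_rot v u w) /l.
by case: (closed3 v u w); case: (heavy v); case: (heavy u); case: (heavy w).
Qed.

End TriangleCount.

(** * Repeated samples and their second moment *)

Section Sampling.
Variables (R : realType) (n : nat) (G : sgraph n) (D : nat).
Hypotheses (n0 : (0 < n)%N) (D0 : (0 < D)%N).
Implicit Types (phi : bool -> R) (acc : nat -> bool).

Local Notation heavy := (heavy G D).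

Definition sample (v : 'I_n) (i j : nat) : nat :=
  if (i < size (nbrs G v))%N && (j < size (nbrs G v))%N
  then hit G D (nth v (nbrs G v) i) (nth v (nbrs G v) j) else 0%N.

(** The expectation of [phi] at the verdict, with [r] rounds to go and total [z] so far. A general
    [phi] covers acceptance, rejection and their sum at once. *)
Fixpoint rounds phi acc (r z : nat) : R :=
  if r is r'.+1 then
    n%:R^-1 * \sum_(v < n) if heavy v then phi false else
      D%:R^-1 * \sum_(i < D) (D%:R^-1 * \sum_(j < D)
        rounds phi acc r' (z + sample v i j))
  else phi (acc z).

Lemma uavg_le m (F F' : 'I_m -> R) : (forall i, F i <= F' i) ->
  m%:R^-1 * \sum_i F i <= m%:R^-1 * \sum_i F' i.
Proof.
move=> h; rewrite ler_wpM2l ?invr_ge0 ?ler0n //.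
by apply: ler_sum => i _; apply: h.
Qed.

Lemma uavg_cst m (c : R) : (0 < m)%N -> m%:R^-1 * \sum_(i < m) c = c.
Proof.
move=> m0; rewrite sumr_const card_ord -[X in _ * X]mulr_natr mulrC mulfK //.
by rewrite pnatr_eq0 -lt0n.
Qed.

Lemma uavgD m (F F' : 'I_m -> R) :
  m%:R^-1 * \sum_i (F i + F' i) = m%:R^-1 * \sum_i F i + m%:R^-1 * \sum_i F' i.
Proof. by rewrite big_split mulrDr. Qed.

Lemma roundsD phi phi' acc r z :
  rounds (fun b => phi b + phi' b) acc r z = rounds phi acc r z + rounds phi' acc r z.
Proof.
elim: r z => [//|r IH] z /=; rewrite -uavgD; congr (_ * _); apply: eq_bigr => v _.
case: ifP => // _; rewrite -uavgD; congr (_ * _); apply: eq_bigr => i _.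
by rewrite -uavgD; congr (_ * _); apply: eq_bigr => j _.
Qed.

Lemma rounds_cst c acc r z : rounds (fun=> c) acc r z = c.
Proof.
elim: r z => [//|r IH] z /=; rewrite -[RHS](uavg_cst c n0).
congr (_ * _); apply: eq_bigr => v _; case: ifP => // _.
rewrite -[RHS](uavg_cst c D0); congr (_ * _); apply: eq_bigr => i _.
rewrite -[RHS](uavg_cst c D0); congr (_ * _); apply: eq_bigr => j _.
exact: IH.
Qed.

Lemma rounds_out acc r z :
  rounds (fun b => (b == false)%:R) acc r z =
  1 - rounds (fun b => (b == true)%:R) acc r z.
Proof.
rewrite -[X in X - _](rounds_cst 1 acc r z).
rewrite (_ : (fun=> 1) = fun b => (b == false)%:R + (b == true)%:R : R).
  by rewrite roundsD addrK.
by apply/funext => -[]; rewrite ?addr0 ?add0r.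
Qed.

(** A heavy vertex contributes 0 instead of ending the run, so that successive samples are
    independent and identically distributed. *)
Definition lsample v i j := if heavy v then 0%N else sample v i j.

Definition savg (F : nat -> R) : R :=
  n%:R^-1 * \sum_(v < n) (D%:R^-1 * \sum_(i < D) (D%:R^-1 * \sum_(j < D)
    F (lsample v i j))).

Lemma savg_le F F' : (forall y, F y <= F' y) -> savg F <= savg F'.
Proof. by move=> h; do 3! [apply: uavg_le => ?]; apply: h. Qed.

Lemma savgD F F' : savg (fun y => F y + F' y) = savg F + savg F'.
Proof.
rewrite -uavgD; congr (_ * _); apply: eq_bigr => v _.
rewrite -uavgD; congr (_ * _); apply: eq_bigr => i _; exact: uavgD.
Qed.

Lemma savgZ c F : savg (fun y => c * F y) = c * savg F.
Proof.
rewrite /savg mulrCA; congr (_ * _); rewrite mulr_sumr; apply: eq_bigr => v _.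
rewrite mulrCA; congr (_ * _); rewrite mulr_sumr; apply: eq_bigr => i _.
by rewrite mulrCA; congr (_ * _); rewrite mulr_sumr.
Qed.

Lemma savg_cst c : savg (fun=> c) = c.
Proof.
rewrite /savg -[RHS](uavg_cst c n0); congr (_ * _); apply: eq_bigr => v _.
rewrite -[RHS](uavg_cst c D0); congr (_ * _); apply: eq_bigr => i _.
exact: uavg_cst.
Qed.

Definition smean : R := savg (fun y => y%:R).

Lemma hit_le6 u w : (hit G D u w <= 6)%N.
Proof. by rewrite /hit; case: (adj _ _ _); case: heavy; case: heavy. Qed.

Lemma sample_le6 v i j : (sample v i j <= 6)%N.
Proof. by rewrite /sample; case: ifP => // _; apply: hit_le6. Qed.

Lemma lsample_le6 v i j : (lsample v i j <= 6)%N.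
Proof. by rewrite /lsample; case: ifP => // _; apply: sample_le6. Qed.

(** Samples lie between 0 and 6, so rare triangles also mean a small variance. *)
Lemma savg_sq_le : savg (fun y => y%:R ^+ 2) <= 6 * smean.
Proof.
rewrite /smean -savgZ; do 3! [apply: uavg_le => ?].
by rewrite expr2 ler_wpM2r ?ler0n // ler_nat; exact: lsample_le6.
Qed.

Lemma smean_ge0 : 0 <= smean.
Proof. by rewrite -(savg_cst 0); apply: savg_le => y; rewrite ler0n. Qed.

(** The right-hand side is a potential: averaged over one more sample, it does not exceed its value
    before that sample. It bounds the mean squared distance of the final total from [a], divided by
    [b]. A run cut short by a heavy vertex scores at most 0 and only helps. *)
Lemma rounds_chebyshev phi acc (a b : R) r z : 0 < b ->
  (forall v, heavy v -> phi false <= 0) ->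
  (forall y, phi (acc y) <= (y%:R - a) ^+ 2 / b) ->
  rounds phi acc r z <=
    ((z%:R + r%:R * smean - a) ^+ 2 + r%:R * (6 * smean)) / b.
Proof.
move=> b0 hh hacc; elim: r z => [|r IH] z /=.
  by rewrite !mul0r !addr0; apply: hacc.
have bi0 : 0 <= b^-1 by rewrite invr_ge0 ltW.
have W0 r' z' : 0 <= ((z' + r'%:R * smean - a) ^+ 2 + r'%:R * (6 * smean)) / b.
  apply: mulr_ge0 => //; apply: addr_ge0; first exact: sqr_ge0.
  by apply: mulr_ge0 => //; apply: mulr_ge0 => //; apply: smean_ge0.
apply: (@le_trans _ _ (savg (fun y =>
   (((z%:R + y%:R) + r%:R * smean - a) ^+ 2 + r%:R * (6 * smean)) / b))).
  apply: uavg_le => v; case: (boolP (heavy v)) => hv.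
    apply: le_trans (hh v hv) _; rewrite /lsample hv.
    by rewrite mulr_ge0 ?invr_ge0 ?ler0n // sumr_ge0 // => i _;
      rewrite mulr_ge0 ?invr_ge0 ?ler0n // sumr_ge0 // => j _; apply: W0.
  do 2! [apply: uavg_le => ?]; rewrite /lsample (negbTE hv).
  by apply: le_trans (IH _) _; rewrite natrD.
pose c := z%:R + r%:R * smean - a.
rewrite (_ : (fun y => _) = (fun y => ((c ^+ 2 + r%:R * (6 * smean)) / b) +
   ((2 * c / b) * y%:R + b^-1 * y%:R ^+ 2)) :> (nat -> R)); last first.
  by apply/funext => y; rewrite /c; ring.
rewrite !savgD !savgZ savg_cst -/smean.
apply: (@le_trans _ _ ((c ^+ 2 + r%:R * (6 * smean)) / b +
   (2 * c / b * smean + b^-1 * (6 * smean)))).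
  by rewrite lerD2l lerD2l ler_wpM2l // savg_sq_le.
have -> : (c ^+ 2 + r%:R * (6 * smean)) / b + (2 * c / b * smean + b^-1 * (6 * smean))
  = (c ^+ 2 + 2 * c * smean + r.+1%:R * (6 * smean)) / b.
  by rewrite -[r.+1]addn1 natrD; ring.
rewrite ler_wpM2r // lerD2r.
rewrite (_ : z%:R + r.+1%:R * smean - a = c + smean); last first.
  by rewrite /c -[r.+1]addn1 natrD; ring.
by rewrite -subr_ge0 (_ : _ - _ = smean ^+ 2) ?sqr_ge0 //; ring.
Qed.

(** Acceptance requires all [r] drawn vertices to be light. *)
Lemma rounds_heavy acc r z :
  rounds (fun b => (b == true)%:R) acc r z <= (1 - #|heavy_set G D|%:R / n%:R) ^+ r.
Proof.
have n0R : 0 < n%:R :> R by rewrite ltr0n.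
have x0 : 0 <= 1 - #|heavy_set G D|%:R / n%:R :> R.
  rewrite subr_ge0 ler_pdivrMr // mul1r ler_nat.
  by apply: leq_trans (max_card _) _; rewrite card_ord.
elim: r z => [|r IH] z /=; first by rewrite lern1 leq_b1.
set x := 1 - _ in x0 IH *.
apply: (@le_trans _ _ (n%:R^-1 * \sum_(v < n) (~~ heavy v)%:R * x ^+ r)).
  apply: uavg_le => v; case: ifP => _ /=; first by rewrite mul0r.
  rewrite mul1r -[leRHS](uavg_cst _ D0); apply: uavg_le => i.
  by rewrite -[leRHS](uavg_cst _ D0); apply: uavg_le => j.
rewrite -mulr_suml mulrA exprS ler_wpM2r ?exprn_ge0 //.
have -> : \sum_(v < n) (~~ heavy v)%:R = n%:R - #|heavy_set G D|%:R :> R.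
  have -> : n%:R = \sum_(v < n) 1 :> R by rewrite sumr_const card_ord.
  rewrite -sum1_card natr_sum [X in _ - X]big_mkcond -sumrB.
  by apply: eq_bigr => v _; rewrite inE; case: heavy; rewrite ?subrr ?subr0.
by rewrite mulrC mulrBl divff ?gt_eqF.
Qed.

(** Ranks run up to the cap instead of the degree; for a light vertex no neighbour is missed and
    surplus ranks contribute 0. *)
Lemma sum_nbrs (v : 'I_n) (f : 'I_n -> nat) : ~~ heavy v ->
  (\sum_(i < D) (if i < size (nbrs G v) then f (nth v (nbrs G v) i) else 0) =
   \sum_(u | adj G v u) f u)%N.
Proof.
rewrite -leqNgt => dD.
transitivity (\sum_(u <- nbrs G v) f u)%N; last first.
  by rewrite /nbrs big_filter big_enum_cond.
rewrite (big_nth v) big_mkord (big_ord_widen_cond _ xpredT (fun i => f (nth v (nbrs G v) i)) dD).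
by rewrite [RHS]big_mkcond.
Qed.

Lemma smeanE : exists2 H : nat,
  n%:R * D%:R ^+ 2 * smean = 12 * (C3 G)%:R - 2 * H%:R & (H <= #|heavy_set G D| ^ 3)%N.
Proof.
have [H HE Hle] := sum_hits G D; exists H => //.
apply/eqP; rewrite eq_sym subr_eq eq_sym; apply/eqP.
rewrite -!natrM -HE natrD; congr (_ + _).
rewrite natr_sum /smean /savg.
have n0R : n%:R != 0 :> R by rewrite pnatr_eq0 -lt0n.
have D0R : D%:R != 0 :> R by rewrite pnatr_eq0 -lt0n.
rewrite [n%:R * _]mulrC -mulrA mulVKf // [RHS]big_mkcond.
rewrite mulr_sumr; apply: eq_bigr => v _.
case: ifP => hv; last first.
  by rewrite big1 ?mulr0 // => i _; rewrite big1 ?mulr0 // => j _; rewrite /lsample (negbFE hv).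
rewrite -(@sum_nbrs v (fun u => \sum_(w | adj G v w) hit G D u w)%N) //.
rewrite natr_sum expr2 !mulrA mulfK // mulr_sumr; apply: eq_bigr => i _.
rewrite mulrA mulfV // mul1r /lsample (negbTE hv) /sample.
case: ifP => hi; last by rewrite big1 // => j _; rewrite hi.
rewrite -sum_nbrs // natr_sum; apply: eq_bigr => j _.
by [].
Qed.

End Sampling.

(** * Runs of RAM programs *)

Section Ram.
Variables (R : realType) (n W : nat) (G : sgraph n) (s0 : seq cmd * mem).
Implicit Types (M : mem) (k : seq cmd) (phi : bool -> R).

Local Notation A := (@QAlg n (seq cmd * mem)%type s0 (@ram_next n W)).

(* From [s] the program halts within [T] steps, and [v] is the expectation of
   [phi] at its output. *)
Definition computes phi (T : nat) (s : seq cmd * mem) (v : R) : Prop :=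
  (forall t, (T <= t)%N -> erun (A := A) G (fun=> 0 : R) phi t s = v) /\
  (forall t, erun (A := A) G (fun=> 1 : R) (fun=> 1) t s <= T%:R).

Lemma computes_leq phi T T' s v :
  (T <= T')%N -> computes phi T s v -> computes phi T' s v.
Proof.
move=> TT' [h1 h2]; split=> t => [T't|]; first by rewrite h1 // (leq_trans TT').
by apply: le_trans (h2 t) _; rewrite ler_nat.
Qed.

Lemma computes_halt phi s b : ram_next n W s = Halt n _ b ->
  computes phi 1 s (phi b).
Proof. by move=> h; split=> -[|t] //=; rewrite h // => _; rewrite ler1n. Qed.

Lemma computes_next phi s s' T v :
  (ram_next n W s = Tick n s' \/
   exists q f, ram_next n W s = Ask q f /\ s' = f (answer G q)) ->
  computes phi T s' v -> computes phi T.+1 s v.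
Proof.
move=> h [h1 h2]; split=> -[|t] //=.
- by move=> Tt; case: h => [->|[q [k [-> <-]]]]; rewrite add0r h1.
- by case: h => [->|[q [k [-> <-]]]]; rewrite -addn1 natrD addrC lerD2r.
Qed.

Lemma computes_rand phi T k M d a m (v : 'I_m -> R) : M a = m -> (0 < m)%N ->
  (forall i : 'I_m, computes phi T (k, upd W M d i) (v i)) ->
  computes phi T.+1 (Rand d a :: k, M) (m%:R^-1 * \sum_(i < m) v i).
Proof.
case: m v => // m v Ma _ h; split=> -[|t] //=; rewrite Ma /=.
  move=> Tt; rewrite add0r; congr (_ * _); apply: eq_bigr => i _.
  by have [-> //] := h i.
rewrite -[T.+1]addn1 natrD [leRHS]addrC lerD2l -[leRHS](avg_cst m); apply: avg_le => i.
by have [_] := h i.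
Qed.

Definition qadj (x y : nat) : nat :=
  match insub x, insub y with
  | Some u, Some v => adj G u v : nat
  | _, _ => 0%N
  end.
Definition qnbr (x i : nat) : nat :=
  if insub x is Some u then answer G (QNbr u i) else 0%N.
Definition qdeg (x : nat) : nat :=
  if insub x is Some u then size (nbrs G u) else 0%N.
Arguments qadj : simpl never.
Arguments qnbr : simpl never.
Arguments qdeg : simpl never.

Lemma nbrs_size_le u : (size (nbrs G u) <= n)%N.
Proof.
by rewrite size_filter; apply: leq_trans (count_size _ _) _; rewrite size_enum_ord.
Qed.

Lemma qnbr_le x i : (qnbr x i <= n)%N.
Proof.
rewrite /qnbr; case: insub => //= u.
case: (ltnP i (size (nbrs G u))) => h; last by rewrite nth_default // size_map.
by rewrite (nth_map u).
Qed.

Lemma qdeg_le x : (qdeg x <= n)%N.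
Proof. by rewrite /qdeg; case: insub => //= u; apply: nbrs_size_le. Qed.

Lemma qadj_le x y : (qadj x y <= 1)%N.
Proof. by rewrite /qadj; case: insub => // u; case: insub => // v; apply: leq_b1. Qed.

Lemma qadjE (u v : 'I_n) : qadj u v = adj G u v.
Proof. by rewrite /qadj !valK. Qed.

Lemma qdegE (u : 'I_n) : qdeg u = size (nbrs G u).
Proof. by rewrite /qdeg valK. Qed.

Lemma qnbrE (u : 'I_n) i : qnbr u i =
  if (i < size (nbrs G u))%N then (nth u (nbrs G u) i).+1 else 0%N.
Proof.
rewrite /qnbr valK /=; case: ltnP => h; first by rewrite (nth_map u).
by rewrite nth_default // size_map.
Qed.

(** [upd] without wrap-around; the two agree while no word overflows. *)
Definition mset M d x : mem := fun i => if eqn i d then x else M i.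

Definition effect M (c : cmd) : option (nat * nat) :=
  match c with
  | Lit d x => Some (d, x)
  | Bin o d a b => Some (d, eval_binop o (M a) (M b))
  | AdjQ d u v => Some (d, qadj (M u) (M v))
  | NbrQ d u i => Some (d, qnbr (M u) (M i))
  | DegQ d u => Some (d, qdeg (M u))
  | _ => None
  end.

(** For straight-line code: control flow, draws and indirect addressing end it. *)
Fixpoint exec M (cs : seq cmd) : mem :=
  if cs is c :: cs' then
    if effect M c is Some (d, x) then exec (mset M d x) cs' else M
  else M.

(* Sizes are tracked as exponents of [n], so that the absence of word overflow
   is checked by a closed computation. *)
Definition bounded (b : seq nat) M := forall i, (M i <= n ^ nth 0%N b i)%N.

(** As [n >= 3], a sum exceeds the larger exponent by at most one, and a literal is bounded through
    its logarithm to base 3. Truth values are at most [n ^ 0]. *)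
Definition bound_effect (b : seq nat) (c : cmd) : option (nat * nat) :=
  match c with
  | Lit d x => Some (d, up_log 3 x)
  | Bin o d x y => Some (d,
      match o with
      | Add => (maxn (nth 0 b x) (nth 0 b y)).+1
      | Mul => nth 0 b x + nth 0 b y
      | Lt | Eq => 0
      | Sub | Div | Mod => nth 0 b x
      end%N)
  | AdjQ d u v => Some (d, 0%N)
  | NbrQ d u i => Some (d, 1%N)
  | DegQ d u => Some (d, 1%N)
  | _ => None
  end.

Fixpoint bound_exec K (b : seq nat) (cs : seq cmd) : option (seq nat) :=
  if cs is c :: cs' then
    if bound_effect b c is Some (d, e) then
      if (e < K)%N then bound_exec K (set_nth 0%N b d e) cs' else None
    else None
  else Some b.

Hypothesis n3 : (3 <= n)%N.

Lemma bound_effectP b c M d e : bounded b M -> bound_effect b c = Some (d, e) ->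
  exists2 x, effect M c = Some (d, x) & (x <= n ^ e)%N.
Proof.
move=> bM; have n0 : (0 < n)%N by apply: leq_trans n3.
case: c => //= [d' x|o d' x y|d' u v|d' u i|d' u] [<- <-]; eexists=> //.
- case: x => [|x] //; apply: leq_trans (up_logP x.+1 (isT : 1 < 3)%N) _.
  by case: (up_log 3 x.+1) => // e'; rewrite leq_exp2r.
- have hx := bM x; have hy := bM y.
  have mono a b' : (a <= b' -> n ^ a <= n ^ b')%N by apply: leq_pexp2l.
  case: o => /=.
  + rewrite expnS; apply: (@leq_trans (2 * n ^ maxn (nth 0 b x) (nth 0 b y))%N).
      rewrite mul2n -addnn leq_add //; first exact: leq_trans hx (mono _ _ (leq_maxl _ _)).
      exact: leq_trans hy (mono _ _ (leq_maxr _ _)).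
    by rewrite leq_mul2r (leq_trans _ n3) ?orbT.
  + exact: leq_trans (leq_subr _ _) hx.
  + by rewrite expnD leq_mul.
  + exact: leq_trans (leq_div _ _) hx.
  + exact: leq_trans (leq_mod _ _) hx.
  + exact: leq_b1.
  + exact: leq_b1.
- exact: qadj_le.
- by rewrite expn1 qnbr_le.
- by rewrite expn1 qdeg_le.
Qed.

Lemma bounded_mset b M d e x : bounded b M -> (x <= n ^ e)%N ->
  bounded (set_nth 0%N b d e) (mset M d x).
Proof.
move=> bM xe i; rewrite /mset nth_set_nth /=.
by rewrite -[eqn i d]/(i == d); case: eqP.
Qed.

Lemma updE M d x : (x < W)%N -> upd W M d x = mset M d x.
Proof. by move=> xW; rewrite /upd modn_small. Qed.

Lemma ram_next_effect M c k d x : effect M c = Some (d, x) ->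
  ram_next n W (c :: k, M) = Tick n (k, upd W M d x) \/
  exists q f, ram_next n W (c :: k, M) = Ask q f /\
    (k, upd W M d x) = f (answer G q).
Proof.
case: c => //= [d' x'|o d' x' y|d' u v|d' u i|d' u] [<- <-]; try by left.
- rewrite /qadj; case: insubP => [u' _ _|_]; last by left.
  by case: insubP => [v' _ _|_]; [right; eexists; eexists | left].
- rewrite /qnbr; case: insubP => [u' _ _|_]; last by left.
  by right; eexists; eexists.
- rewrite /qdeg; case: insubP => [u' _ _|_]; last by left.
  by right; eexists; eexists.
Qed.

Lemma bounded_exec K b b' M cs : bounded b M ->
  bound_exec K b cs = Some b' -> bounded b' (exec M cs).
Proof.
elim: cs b M => [|c cs IH] b M bM /=; first by move=> [<-].
case E: (bound_effect b c) => [[d e]|] //; case: ifP => // eK h.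
have [x -> xe] := bound_effectP bM E.
by apply: IH h; apply: bounded_mset.
Qed.

(** Success of [bound_exec] keeps every intermediate value below [n ^ K], so nothing wraps and the
    machine follows [exec]. *)
Lemma computes_exec phi K b b' M cs k T v : W = (n ^ K)%N -> bounded b M ->
  bound_exec K b cs = Some b' -> computes phi T (k, exec M cs) v ->
  computes phi (size cs + T) (cs ++ k, M) v.
Proof.
move=> WE; elim: cs b M => [|c cs IH] b M bM //=.
case E: (bound_effect b c) => [[d e]|] //; case: ifP => // eK h hv.
have [x xE xe] := bound_effectP bM E; rewrite xE in hv.
rewrite addSn; apply: computes_next (ram_next_effect (cs ++ k) xE) _.
rewrite updE; first by apply: IH h hv; apply: bounded_mset.
by apply: leq_ltn_trans xe _; rewrite WE ltn_exp2l // (leq_trans _ n3).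
Qed.

Lemma computes_if phi T k M a c1 c2 v :
  computes phi T ((if M a != 0%N then c1 else c2) ++ k, M) v ->
  computes phi T.+1 (If a c1 c2 :: k, M) v.
Proof. by apply: computes_next; left. Qed.

Lemma computes_while phi T k M a c v :
  computes phi T (if M a != 0%N then c ++ While a c :: k else k, M) v ->
  computes phi T.+1 (While a c :: k, M) v.
Proof. by apply: computes_next; left. Qed.

End Ram.

(** * The program *)

(* Cells: 5 = L, about log2 n; 7 = scale n; 8 = min(eps, 20); 10 = the degree cap
   D; 13 = the number of samples; 14 = samples still to draw; 15 = the sum Z of
   the weights; 16 = the sampled vertex v; 19, 20 = the two neighbour ranks;
   30 is never written and holds 0. *)
Definition prologue : seq cmd := [:: Lit 3 1; Lit 6 2; Bin Mul 4 0 3].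
Definition log_body : seq cmd := [:: Bin Div 4 4 6; Bin Add 5 5 3].
(** Cell 7 is obtained by four squarings, and min(eps, 20) as [a - (a - b)] with truncated
    subtraction. Multiplication by cell 3, which holds 1, makes a copy. *)
Definition setup : seq cmd :=
  [:: Bin Mul 7 0 0; Bin Mul 7 7 7; Bin Mul 7 7 7; Bin Mul 7 7 7;
      Lit 8 20; Bin Mul 8 8 7; Bin Sub 9 8 2; Bin Sub 8 8 9;
      Bin Mul 10 1 0; Bin Div 10 10 7; Bin Mul 10 10 6; Bin Add 10 10 5;
      Lit 9 12; Bin Add 10 10 9;
      Bin Mul 11 1 0; Bin Mul 12 11 11; Bin Mul 12 12 11;
      Bin Mul 9 8 8; Bin Mul 12 12 9;
      Bin Mul 9 7 7; Bin Mul 9 9 9; Bin Mul 9 9 7;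
      Bin Div 12 12 9; Bin Add 12 12 3;
      Lit 13 32; Bin Mul 13 13 13; Bin Mul 13 13 13; Bin Mul 13 13 0;
      Bin Mul 13 13 10; Bin Mul 13 13 10; Bin Div 13 13 12; Bin Add 13 13 3;
      Bin Mul 14 13 3].
(** An answer to [NbrQ] is 0 or a vertex plus one. For a missing neighbour the truncated subtraction
    yields vertex 0, and the comparison of cell 30 with the answer cancels the sample. *)
Definition sample_code : seq cmd :=
  [:: NbrQ 21 16 19; NbrQ 22 16 20; Bin Sub 23 21 3; Bin Sub 24 22 3;
      AdjQ 25 23 24;
      DegQ 26 23; Bin Lt 26 10 26; DegQ 27 24; Bin Lt 27 10 27;
      Lit 28 3; Bin Sub 28 28 26; Bin Sub 28 28 27; Lit 29 6;
      Bin Div 28 29 28; Bin Mul 28 25 28;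
      Bin Lt 21 30 21; Bin Lt 22 30 22; Bin Mul 28 28 21; Bin Mul 28 28 22;
      Bin Add 15 15 28; Bin Sub 14 14 3].
Definition round_code : seq cmd :=
  [:: Rand 16 0, DegQ 17 16, Bin Lt 18 10 17, If 18 [:: Output false] [::],
      Rand 19 10, Rand 20 10 & sample_code].
(** With all denominators cleared, [2 Z D ^ 2 N ^ 4] is compared with [(n - 1) (n - 2) s P ^ 3]
    times [4 N + 3 E] and [4 N - 3 E], where [N] is the scale. *)
Definition verdict_code : seq cmd :=
  [:: Bin Sub 16 0 3; Bin Sub 17 0 6; Bin Mul 16 16 17; Bin Mul 16 16 13;
      Bin Mul 16 16 1; Bin Mul 16 16 1; Bin Mul 16 16 1;
      Lit 17 4; Bin Mul 17 17 7; Lit 18 3; Bin Mul 18 18 8;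
      Bin Add 19 17 18; Bin Sub 20 17 18; Bin Mul 19 16 19; Bin Mul 20 16 20;
      Bin Mul 21 15 10; Bin Mul 21 21 10; Bin Mul 21 21 6;
      Bin Mul 22 7 7; Bin Mul 22 22 22; Bin Mul 21 21 22;
      Bin Lt 23 19 21; Bin Lt 24 21 20; Bin Add 23 23 24].
Definition epilogue : seq cmd :=
  verdict_code ++ [:: If 23 [:: Output false] [:: Output true]].
Definition triangle_prog : seq cmd :=
  prologue ++ While 4 log_body :: setup ++ While 14 round_code :: epilogue.

(* Larger than every exponent met in the program. *)
Definition word_exp : nat := 250%N.

Section Program.
Variables (R : realType) (n : nat) (G : sgraph n) (s0 : seq cmd * mem).
Hypothesis n3 : (3 <= n)%N.
Implicit Types (M : mem) (phi : bool -> R).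

Local Notation W := (n ^ word_exp)%N.
Local Notation computes := (@computes R n W G s0).
Local Notation exec := (@exec n G).

Definition verdict M (z : nat) : bool :=
  let c := ((M 0 - M 3) * (M 0 - M 6) * M 13 * M 1 * M 1 * M 1)%N in
  let x := (z * M 10 * M 10 * M 6 * ((M 7 * M 7) * (M 7 * M 7)))%N in
  ~~ ((c * (4 * M 7 + 3 * M 8) < x)%N + (x < c * (4 * M 7 - 3 * M 8))%N != 0)%N.

Definition params : seq nat := [:: 0; 1; 3; 6; 7; 8; 10; 13; 30]%N.

Definition same_params M M' := forall i, i \in params -> M' i = M i.

Lemma verdict_same M M' z : same_params M M' -> verdict M' z = verdict M z.
Proof. by move=> h; rewrite /verdict !h. Qed.

Definition setup_bounds : seq nat :=
  [:: 1; 16; word_exp; 0; 1; 2; 1]%N.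

(** Exponents preserved by a round. For cell 15 the exponent calculus would add one per round; the
    bound [n ^ 60] comes instead from at most [n ^ 58] samples of size at most 6. *)
Definition round_bounds : seq nat :=
  [:: 1; 16; word_exp; 0; 1; 2; 1; 16; 19; 80; 20; 17; 90; 58; 58; 60;
   1; 1; 0; 20; 20; 1; 1; 1; 1; 0; 1; 1; 2; 2]%N.

Lemma bounded_le b b' M : all (fun i => nth 0 b i <= nth 0 b' i)%N (iota 0 (size b)) ->
  bounded n b M -> bounded n b' M.
Proof.
move=> /allP h bM i; apply: leq_trans (bM i) _; apply: leq_pexp2l.
  by apply: leq_trans n3.
case: (ltnP i (size b)) => hi; last by rewrite nth_default.
by apply: h; rewrite mem_iota.
Qed.

Lemma epilogue_computes phi M : bounded n round_bounds M ->
  computes phi 26 (epilogue, M) (phi (verdict M (M 15))).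
Proof.
move=> bM.
pose b' := odflt [::] (bound_exec word_exp round_bounds verdict_code).
apply: (@computes_exec _ _ _ _ _ n3 _ word_exp round_bounds b' _ verdict_code) => //.
apply: computes_if; apply: computes_halt.
rewrite (_ : verdict _ _ = ~~ (exec M verdict_code 23 != 0)%N); last first.
  by [].
by case: (_ != 0)%N.
Qed.

Lemma bounded_set b M d e : bounded n b M -> (M d <= n ^ e)%N ->
  bounded n (set_nth 0%N b d e) M.
Proof. by move=> bM Md i; rewrite nth_set_nth /=; case: eqP => [->|]. Qed.

Lemma expn_lt_word e : (e < word_exp)%N -> (n ^ e < W)%N.
Proof. by move=> h; rewrite ltn_exp2l // (leq_trans _ n3). Qed.

Lemma lt_word e x : (x <= n ^ e)%N -> (e < word_exp)%N -> (x < W)%N.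
Proof. by move=> xe /expn_lt_word; apply: leq_ltn_trans. Qed.

Definition round_mem M (v i j : nat) : mem :=
  exec (mset (mset (exec (mset M 16 v) [:: DegQ 17 16; Bin Lt 18 10 17]) 19 i) 20 j)
    sample_code.

Lemma round_mem_sample M D (v : 'I_n) i j : M 3 = 1%N -> M 10 = D -> M 30 = 0%N ->
  round_mem M v i j 15 = (M 15 + sample G D v i j)%N.
Proof.
move=> M3 M10 M30.
pose a := qnbr G v i; pose b := qnbr G v j.
have -> : round_mem M v i j 15 = (M 15 +
  qadj G (a - M 3) (b - M 3) * (6 %/ (3 - (M 10 < qdeg G (a - M 3))
     - (M 10 < qdeg G (b - M 3)))) * (M 30 < a) * (M 30 < b))%N by [].
rewrite M3 M10 M30; congr (_ + _)%N; rewrite /a /b !qnbrE /sample.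
case: ltnP => // hi; case: ltnP => //= hj; rewrite ?muln0 ?muln1 //.
by rewrite !subn1 /= qadjE !qdegE.
Qed.

Lemma round_mem_params M v i j x : x \in params -> round_mem M v i j x = M x.
Proof.
rewrite /params !inE.
by do 8! [case/orP=> [/eqP -> | ]; first by []]; move/eqP ->.
Qed.

Lemma round_mem_count M v i j : round_mem M v i j 14 = (M 14 - M 3)%N.
Proof. by []. Qed.

Lemma sample_code_bounded M : bounded n round_bounds M ->
  (exec M sample_code 15 <= n ^ 60)%N -> bounded n round_bounds (exec M sample_code).
Proof.
move=> bM h; pose b := odflt [::] (bound_exec word_exp round_bounds sample_code).
apply: (@bounded_le (set_nth 0%N b 15 60)); first by vm_compute.
apply: bounded_set h; apply: (@bounded_exec _ _ n3 word_exp round_bounds) => //.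
Qed.

(** A round takes 28 steps; the other 27 are the last loop test and the epilogue. The condition on
    [z + 6 * r] is the invariant that bounds the total. *)
Lemma rounds_computes phi M0 D r z M : M0 0 = n -> M0 3 = 1%N -> M0 30 = 0%N ->
  M0 10 = D -> (0 < D)%N -> (M0 13 <= n ^ 58)%N ->
  same_params M0 M -> bounded n round_bounds M -> M 14 = r -> M 15 = z ->
  (z + 6 * r <= 6 * M0 13)%N ->
  computes phi (28 * r + 27) (While 14 round_code :: epilogue, M)
    (rounds G D phi (verdict M0) r z).
Proof.
move=> M00 M03 M030 M010 D0 M013.
have s60 : (6 * M0 13 <= n ^ 60)%N.
  rewrite (_ : 60 = 2 + 58)%N // expnD leq_mul // (@leq_trans (3 ^ 2)%N) //.
  by rewrite leq_exp2r.
elim: r z M => [|r IH] z M sM bM M14 M15 zle.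
  rewrite muln0 add0n; apply: computes_while; rewrite M14 /=.
  by rewrite -(verdict_same _ sM) -M15; apply: epilogue_computes.
have n0 : (0 < n)%N by apply: leq_trans n3.
have -> : (28 * r.+1 + 27 = (((28 * r + 48).+2.+1 + 2).+1).+1)%N by lia.
apply: computes_while; rewrite M14 [in X in computes _ _ X _]/=.
have M0n : M 0 = n by rewrite sM.
have MD : M 10 = D by rewrite sM.
have M3 : M 3 = 1%N by rewrite sM.
have M30 : M 30 = 0%N by rewrite sM.
rewrite [rounds _ _ _ _ _ _]/=.
apply: computes_rand => // v.
have DW : (D < W)%N by apply: (@lt_word 20) => //; rewrite -MD; apply: bM.
rewrite updE; last by apply: (ltn_trans (ltn_ord v)); apply: (@lt_word 1); rewrite ?expn1.
rewrite addnC.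
have bM1 : bounded n round_bounds (mset M 16 v).
  apply: (@bounded_le (set_nth 0%N round_bounds 16 1)) => //.
  by apply: bounded_mset => //; rewrite expn1 ltnW.
pose b2 := odflt [::] (bound_exec word_exp round_bounds [:: DegQ 17 16; Bin Lt 18 10 17]).
set k := While 14 round_code :: epilogue in IH *.
apply: (@computes_exec _ _ _ _ _ n3 _ word_exp round_bounds b2 _
  [:: DegQ 17 16; Bin Lt 18 10 17]
  (If 18 [:: Output false] [::] :: Rand 19 10 :: Rand 20 10 :: sample_code ++ k)) => //.
have bM2 : bounded n round_bounds (exec (mset M 16 v) [:: DegQ 17 16; Bin Lt 18 10 17]).
  apply: (@bounded_le b2) => //.
  exact: (@bounded_exec _ _ n3 word_exp round_bounds).
apply: computes_if.
have -> : (exec (mset M 16 v) [:: DegQ 17 16; Bin Lt 18 10 17] 18 != 0)%N = heavy G D v.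
  have -> : exec (mset M 16 v) [:: DegQ 17 16; Bin Lt 18 10 17] 18 =
     (M 10 < qdeg G v)%N by [].
  by rewrite MD qdegE /heavy; case: ltnP.
set M2 := exec _ _ in bM2 *.
case: (heavy G D v).
  by apply: computes_leq (_ : 1 <= _)%N _ => //; apply: computes_halt.
have M2D : M2 10 = D by rewrite -MD.
rewrite cat0s; apply: computes_rand => // i.
rewrite updE; last exact: ltn_trans (ltn_ord i) DW.
apply: computes_rand; rewrite // => j.
rewrite updE; last exact: ltn_trans (ltn_ord j) DW.
have D20 : (D <= n ^ 20)%N by rewrite -MD; apply: bM.
have bM3 : bounded n round_bounds (mset (mset M2 19 i) 20 j).
  apply: (@bounded_le (set_nth 0%N (set_nth 0%N round_bounds 19 20) 20 20)) => //.
  apply: bounded_mset; first apply: bounded_mset => //.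
    exact: leq_trans (ltnW (ltn_ord i)) D20.
  exact: leq_trans (ltnW (ltn_ord j)) D20.
have -> : (28 * r + 48 = size sample_code + (28 * r + 27))%N by rewrite /=; lia.
pose b3 := odflt [::] (bound_exec word_exp round_bounds sample_code).
apply: (@computes_exec _ _ _ _ _ n3 _ word_exp round_bounds b3) => //.
have EM : exec (mset (mset M2 19 i) 20 j) sample_code = round_mem M v i j.
  by rewrite /round_mem -/M2.
rewrite EM.
have M'15 : round_mem M v i j 15 = (z + sample G D v i j)%N.
  by rewrite (@round_mem_sample M D v i j M3 MD M30) M15.
have z'le : (z + sample G D v i j + 6 * r <= 6 * M0 13)%N.
  apply: leq_trans zle; rewrite mulnS addnA leq_add2r leq_add2l.
  exact: sample_le6.
clear DW; apply: (IH _ _ _ _ _ M'15 z'le).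
- move=> x xp; rewrite (@round_mem_params M v i j x xp).
  exact: sM.
- rewrite -EM; apply: sample_code_bounded bM3 _; rewrite EM.
  rewrite M'15; exact: leq_trans (leq_trans (leq_addr _ _) z'le) s60.
- by rewrite round_mem_count M14 (sM 3%N isT) M03 subn1.
Qed.

(** The first and third inequalities say that cell 4 holds [n %/ 2 ^ l]. The bound on the counter
    comes from [l < 2 ^ l], as its exponent would otherwise grow with each pass. *)
Lemma log_loop_computes M y l : M 3 = 1%N -> M 6 = 2%N -> M 4 = y -> M 5 = l ->
  bounded n setup_bounds M ->
  (n < 2 ^ l * y.+1)%N -> (2 ^ l <= 2 * n)%N -> (2 ^ l * y <= n)%N ->
  exists L M', [/\ (n < 2 ^ L <= 2 * n)%N, (l <= L)%N, M' 5 = L,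
    (forall i, i != 4%N -> i != 5%N -> M' i = M i) /\ bounded n setup_bounds M' &
    forall phi k T v, computes phi T (k, M') v ->
      computes phi (3 * (L - l) + 1 + T) (While 4 log_body :: k, M) v].
Proof.
elim/ltn_ind: y l M => y IH l M M3 M6 M4 M5 bM i1 i2 i3.
case: (posnP y) => y0.
  exists l, M; split => //; first by rewrite i2 andbT; rewrite y0 muln1 in i1.
  move=> phi k T v h; rewrite subnn muln0 add0n add1n.
  by apply: computes_while; rewrite M4 y0.
have l2 : (2 ^ l * 1 <= n)%N by apply: leq_trans i3; rewrite leq_mul2l y0 orbT.
have lM : (l.+1 <= n ^ 2)%N.
  apply: leq_trans (ltn_expl l (isT : 1 < 2)%N) _; rewrite muln1 in l2.
  by apply: leq_trans l2 _; rewrite -{1}(expn1 n) leq_pexp2l // (leq_trans _ n3).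
have y'y : (y %/ 2 < y)%N by rewrite ltn_Pdiv.
pose b2 := odflt [::] (bound_exec word_exp setup_bounds log_body).
have bM2 : bounded n setup_bounds (exec M log_body).
  apply: (@bounded_le (set_nth 0%N b2 5 2)) => //; apply: bounded_set.
    exact: (@bounded_exec _ _ n3 word_exp setup_bounds).
  have -> : exec M log_body 5 = (M 5 + M 3)%N by [].
  by rewrite M5 M3 addn1.
have dE := divn_eq y 2; have dm : (y %% 2 < 2)%N by rewrite ltn_mod.
have e4 : exec M log_body 4 = (y %/ 2)%N.
  by transitivity (M 4 %/ M 6)%N; [by [] | rewrite M4 M6].
have e5 : exec M log_body 5 = l.+1.
  by transitivity (M 5 + M 3)%N; [by [] | rewrite M5 M3 addn1].
have j1 : (n < 2 ^ l.+1 * (y %/ 2).+1)%N.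
  by rewrite expnS; move: (2 ^ l)%N i1 => e; nia.
have j2 : (2 ^ l.+1 <= 2 * n)%N by rewrite expnS leq_mul2l -[X in (X <= _)%N]muln1.
have j3 : (2 ^ l.+1 * (y %/ 2) <= n)%N.
  by rewrite expnS; move: (2 ^ l)%N i3 => e; nia.
have [L [M' [h1 h3 h4 [h5 h5'] h6]]] :=
  IH _ y'y l.+1 (exec M log_body) M3 M6 e4 e5 bM2 j1 j2 j3.
exists L, M'; split => //; first exact: ltnW.
  split=> // i i4 i5; rewrite h5 //.
  have -> : exec M log_body i = if eqn i 5 then (M 5 + M 3)%N else
    if eqn i 4 then (M 4 %/ M 6)%N else M i by [].
  by rewrite -[eqn i 5]/(i == 5)%N -[eqn i 4]/(i == 4)%N (negbTE i4) (negbTE i5).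
move=> phi k T v h.
have -> : (3 * (L - l) + 1 + T = (2 + (3 * (L - l.+1) + 1 + T)).+1)%N.
  by move: h3; lia.
apply: computes_while; rewrite M4 -lt0n y0.
apply: (@computes_exec _ _ _ _ _ n3 _ word_exp setup_bounds b2 _ log_body) => //.
exact: h6.
Qed.

End Program.

(* [P] and [E] are the fixed-point forms of [p] and [eps], with unit
   [1 / scale n = n ^- 16]. *)
Definition scale (n : nat) : nat :=
  let a := (n * n)%N in let b := (a * a)%N in let c := (b * b)%N in (c * c)%N.

Definition cap20 (n E : nat) : nat := (20 * scale n - (20 * scale n - E))%N.

(** With [y = P * n %/ scale n], this gives [2 ^ D = 4 ^ (y + 2) * 2 ^ L * 256]: the first factor
    beats [(1 + p) ^ n], the second the union over the vertices, and the third leaves the error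
    1/256. *)
Definition degree_cap (n P L : nat) : nat :=
  (P * n %/ scale n * 2 + L + 12)%N.

(** About [2 ^ 20 n D ^ 2 / (1 + m)] with m = e^2 (np)^3; the 1 in the denominator covers tiny m.
    The fifth power of the scale cancels the units of three factors [P] and two factors [E]. *)
Definition num_samples (n P E D : nat) : nat :=
  let N4 := (scale n * scale n * (scale n * scale n))%N in
  (32 * 32 * (32 * 32) * n * D * D %/
    (P * n * (P * n) * (P * n) * (E * E) %/ (N4 * scale n) + 1) + 1)%N.

Definition accepts (n P E D s z : nat) : bool :=
  let N4 := (scale n * scale n * (scale n * scale n))%N in
  let c := ((n - 1) * (n - 2) * s * P * P * P)%N in
  let x := (z * D * D * 2 * N4)%N in
  ~~ ((c * (4 * scale n + 3 * E) < x)%N + (x < c * (4 * scale n - 3 * E))%N != 0)%N.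

Lemma triangle_prog_computes (R : realType) (n : nat) (G : sgraph n)
    (s0 : seq cmd * mem) (P E : nat) (M0 : mem) : (3 <= n)%N ->
  M0 0 = n -> M0 1 = P -> M0 2 = E -> (forall i, (2 < i)%N -> M0 i = 0%N) ->
  (P <= n ^ 16)%N -> (E <= n ^ word_exp)%N ->
  exists L, (n < 2 ^ L <= 2 * n)%N /\
    let D := degree_cap n P L in
    let E' := cap20 n E in
    let s := num_samples n P E' D in
    forall phi : bool -> R, computes (n ^ word_exp) G s0 phi (3 * L + 28 * s + 64)
      (triangle_prog, M0) (rounds G D phi (accepts n P E' D s) s 0).
Proof.
move=> n3 M00 M01 M02 M0i Ple Ele.
have n0 : (0 < n)%N by apply: leq_trans n3.
have bM0 : bounded n [:: 1; 16; word_exp]%N M0.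
  move=> [|[|[|i]]]; rewrite ?M00 ?M01 ?M02 //.
  by rewrite M0i.
pose b1 := odflt [::] (bound_exec word_exp [:: 1; 16; word_exp]%N prologue).
pose M1 := exec G M0 prologue.
have bM1 : bounded n setup_bounds M1.
  apply: (@bounded_le _ n3 b1); first by vm_compute.
  exact: (@bounded_exec _ _ n3 word_exp [:: 1; 16; word_exp]%N _ _ prologue bM0).
have M14 : M1 4 = n by transitivity (M0 0 * 1)%N; [by [] | rewrite M00 muln1].
have M15 : M1 5 = 0%N by transitivity (M0 5); [by [] | rewrite M0i].
have i1 : (n < 2 ^ 0 * n.+1)%N by rewrite mul1n.
have i2 : (2 ^ 0 <= 2 * n)%N by rewrite muln_gt0.
have i3 : (2 ^ 0 * n <= n)%N by rewrite mul1n.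
have [L [M2 [nL _ M25 [M2i bM2] hlog]]] := @log_loop_computes R n G s0 n3 M1 n 0%N
  erefl erefl M14 M15 bM1 i1 i2 i3.
exists L; split=> // D E' s phi.
pose M3 := exec G M2 setup.
have M20 : M2 0 = n by rewrite M2i // -M00.
have M21 : M2 1 = P by rewrite M2i // -M01.
have M22 : M2 2 = E by rewrite M2i // -M02.
have M23 : M2 3 = 1%N by rewrite M2i.
have M26 : M2 6 = 2%N by rewrite M2i.
have M215 : M2 15 = 0%N by transitivity (M0 15); [rewrite M2i | rewrite M0i].
have M230 : M2 30 = 0%N by transitivity (M0 30); [rewrite M2i | rewrite M0i].
have e0 : M3 0 = n := M20.
have e1 : M3 1 = P := M21.
have e3 : M3 3 = 1%N := M23.
have e6 : M3 6 = 2%N := M26.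
have e15 : M3 15 = 0%N by exact: M215.
have e30 : M3 30 = 0%N by exact: M230.
have e7 : M3 7 = scale n.
  by transitivity (scale (M2 0)); [reflexivity | rewrite M20].
have e8 : M3 8 = E'.
  by transitivity (cap20 (M2 0) (M2 2)); [reflexivity | rewrite M20 M22].
have e10 : M3 10 = D.
  transitivity (M2 1 * M2 0 %/ scale (M2 0) * M2 6 + M2 5 + 12)%N; first reflexivity.
  by rewrite M20 M21 M26 M25.
pose sx := (let N := scale (M2 0) in let N4 := (N * N * (N * N))%N in
    let D' := (M2 1 * M2 0 %/ N * M2 6 + M2 5 + 12)%N in
    let E'' := cap20 (M2 0) (M2 2) in let x := (M2 1 * M2 0)%N in
    (32 * 32 * (32 * 32) * M2 0 * D' * D' %/
      (x * x * x * (E'' * E'') %/ (N4 * N) + M2 3) + M2 3))%N.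
have sxE : sx = s by rewrite /sx /= M20 M21 M22 M23 M25 M26.
have e13 : M3 13 = s by transitivity sx; first reflexivity.
have e14 : M3 14 = s.
  transitivity (sx * M2 3)%N; first reflexivity.
  by rewrite sxE M23 muln1.
have E3 : exec G M2 setup = M3 by [].
pose b3 := odflt [::] (bound_exec word_exp setup_bounds setup).
have bM3' : bounded n b3 M3.
  exact: (@bounded_exec _ _ n3 word_exp setup_bounds _ _ setup bM2).
have bM3 : bounded n round_bounds M3.
  by apply: (@bounded_le _ n3 b3) bM3'; vm_compute.
have vM3 : verdict M3 = accepts n P E' D s.
  by apply/funext => z; rewrite /verdict e0 e1 e3 e6 e7 e8 e10 e13.
have D0 : (0 < D)%N by rewrite /D /degree_cap addn_gt0 orbT.
clear sxE; clearbody s D E' M3; clear sx.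
have z0 : (0 + 6 * s <= 6 * M3 13)%N by rewrite e13 add0n.
have c3 : computes (n ^ word_exp) G s0 phi (28 * s + 27)
    (While 14 round_code :: epilogue, M3) (rounds G D phi (accepts n P E' D s) s 0).
  rewrite -vM3.
  exact: (@rounds_computes R n G s0 n3 phi M3 D s 0%N M3 e0 e3 e30 e10 D0
    (bM3 13%N) (fun _ _ => erefl) bM3 e14 e15 z0).
rewrite -E3 in c3.
have hb3 : bound_exec word_exp setup_bounds setup = Some b3 by vm_compute.
have c2 := @computes_exec _ _ _ _ _ n3 _ word_exp setup_bounds b3 M2 setup _ _ _
  erefl bM2 hb3 c3.
have {c2 c3}c1 := hlog _ _ _ _ c2.
have hb1 : bound_exec word_exp [:: 1; 16; word_exp]%N prologue = Some b1 by vm_compute.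
have := @computes_exec _ _ _ _ _ n3 _ word_exp [:: 1; 16; word_exp]%N b1 M0 prologue
  _ _ _ erefl bM0 hb1 c1.
set T := (size prologue + _)%N; set T' := (3 * L + _ + _)%N.
suff <- : T = T' by [].
by rewrite /T /T' subn0 /=; clear; lia.
Qed.

(** * Accuracy of the test *)

(* [x] is np, [m] is e^2 (np)^3, [mu] the expected number of triangles, [mu'] and
   [e'] the values computed from the fixed-point inputs, [d] the degree cap,
   [u] the number of samples divided by n d^2, and [eta] the relative rounding
   error. *)
Record numeric_setting (R : realFieldType) (x e m mu mu' e' u d K eta : R) : Prop :=
  NumericSetting {
    ns_x : 0 < x; ns_e : 0 < e; ns_e20 : e <= 20; ns_m : m = e ^+ 2 * x ^+ 3;
    ns_mu_ge : x ^+ 3 <= 27 * mu; ns_mu_le : 6 * mu <= x ^+ 3;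
    ns_xd : x <= d; ns_d : 1 <= d; ns_K : 1000 * 1000 <= K; ns_u : 0 < u;
    ns_uK : K <= u * (1 + m);
    ns_mu'_ge0 : 0 <= mu'; ns_mu' : mu' <= mu;
    ns_e'_ge0 : 0 <= e'; ns_e' : e' <= e;
    ns_eta_ge0 : 0 <= eta; ns_eta : 400 * eta <= e }.

Section Numeric.
Variables (R : realFieldType) (x e m mu mu' e' u d K eta : R).
Hypothesis H : numeric_setting x e m mu mu' e' u d K eta.

Local Ltac setting := case: (H) => x0 e0 e20 mE mu_ge mu_le xd d1 K_ge u0 uK
  mu'_ge0 mu'_le e'_ge0 e'_le eta_ge0 eta_le.

Let hi := mu' * (1 + 3 / 4 * e').
Let lo := mu' * (1 - 3 / 4 * e').

Lemma x3_gt0 : 0 < x ^+ 3. Proof. setting; by rewrite exprn_gt0. Qed.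

Lemma mu_gt0 : 0 < mu.
Proof. setting; by have := x3_gt0; lra. Qed.

Lemma e2_gt0 : 0 < e ^+ 2. Proof. setting; by rewrite exprn_gt0. Qed.

Lemma m_gt0 : 0 < m.
Proof. setting; by rewrite mE mulr_gt0 ?x3_gt0 ?e2_gt0. Qed.

Lemma m_le : m <= 27 * (e ^+ 2 * mu).
Proof. setting; by rewrite mE [leRHS]mulrCA ler_pM2l // exprn_gt0. Qed.

Lemma hi_le : hi <= mu * (1 + 3 / 4 * e).
Proof. setting; by rewrite /hi; apply: ler_pM => //; lra. Qed.

Section Large.
Hypotheses (Hm : 1 <= m) (Hmu' : (1 - eta) * mu <= mu') (He' : e - eta <= e').

Local Ltac large := setting; have := Hm; have := Hmu'; have := He' => h2 h1 m1.

(** This and the next two lemmas confine the rounded edges of the window to between [7 / 10 * e] and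
    [4 / 5 * e], clear of both [e / 2] and [e]. *)
Lemma hi_ge : mu * (1 + 7 / 10 * e) <= hi.
Proof.
large; have := mu_gt0 => mu0.
apply: (@le_trans _ _ ((1 - eta) * mu * (1 + 3 / 4 * e'))); last first.
  by rewrite /hi ler_wpM2r //; lra.
rewrite -[leRHS]mulrA [leRHS]mulrCA ler_pM2l //.
have : (1 - eta) * (1 + 3 / 4 * (e - eta)) <= (1 - eta) * (1 + 3 / 4 * e').
  by rewrite ler_wpM2l //; lra.
apply: le_trans.
have : 0 <= eta * (20 - e) by rewrite mulr_ge0 //; lra.
have : 0 <= eta * eta by rewrite mulr_ge0.
by lra.
Qed.

Lemma lo_le : lo <= mu * (1 - 7 / 10 * e).
Proof.
large; have := mu_gt0 => mu0; rewrite /lo.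
(* The bound [mu' <= mu] helps only if the factor is nonnegative; otherwise the lower bound on [mu']
   is needed. *)
have [s|s] := lerP 0 (1 - 3 / 4 * e').
  apply: (@le_trans _ _ (mu * (1 - 3 / 4 * e'))); first by rewrite ler_wpM2r.
  by rewrite ler_pM2l //; lra.
apply: (@le_trans _ _ ((1 - eta) * mu * (1 - 3 / 4 * e'))).
  by rewrite ler_nM2r.
rewrite -[leLHS]mulrA [leLHS]mulrCA ler_pM2l //.
have : 0 <= eta * (20 - e') by rewrite mulr_ge0 //; lra.
by lra.
Qed.

Lemma lo_ge : e < 1 -> mu * (1 - 4 / 5 * e) <= lo.
Proof.
large; move=> e1; have := mu_gt0 => mu0; rewrite /lo.
apply: (@le_trans _ _ ((1 - eta) * mu * (1 - 3 / 4 * e))); last first.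
  by apply: ler_pM => //; rewrite ?mulr_ge0 ?(ltW mu0) //; lra.
rewrite -[leRHS]mulrA [leRHS]mulrCA ler_pM2l //.
have : 0 <= eta * e by rewrite mulr_ge0 // ltW.
by lra.
Qed.

Lemma u_ge : K <= 2 * u * m.
Proof.
large; apply: le_trans uK _; rewrite [2 * u]mulrC -mulrA ler_pM2l //.
by lra.
Qed.

(* Chebyshev's bound for a deviation [t * mu]. *)
Lemma dev_mu (c t : R) : 0 <= c <= 11 * mu -> 1 / 5 * e <= t ->
  c / (2 * u * (t * mu) ^+ 2) <= 1 / 100.
Proof.
large; move=> /andP[c0 c11] te; have := mu_gt0 => mu0.
have t0 : 0 < t by lra.
rewrite ler_pdivrMr; last by rewrite !mulr_gt0 ?exprn_gt0 ?mulr_gt0.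
apply: (le_trans c11).
have h3 := u_ge.
have h4 : K <= 27 * 25 * (2 * u * t ^+ 2 * mu).
  apply: (le_trans h3); apply: (@le_trans _ _ (2 * u * (27 * (e ^+ 2 * mu)))).
    by rewrite ler_pM2l ?m_le // mulr_gt0.
  have : e ^+ 2 <= 25 * t ^+ 2.
    have : (1 / 5 * e) ^+ 2 <= t ^+ 2 by rewrite ler_sqr ?nnegrE; lra.
    by rewrite exprMn; lra.
  rewrite -(ler_pM2l (_ : 0 < 54 * u * mu)); first by lra.
  by rewrite !mulr_gt0.
have : 0 < mu * (2 * u * t ^+ 2 * mu) by rewrite !mulr_gt0 ?exprn_gt0.
rewrite (_ : 1 / 100 * (2 * u * (t * mu) ^+ 2) = 1 / 100 * (mu * (2 * u * t ^+ 2 * mu)));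
  last by ring.
have : mu * K <= mu * (27 * 25 * (2 * u * t ^+ 2 * mu)) by rewrite ler_pM2l.
have : mu * (1000 * 1000) <= mu * K by rewrite ler_pM2l.
by lra.
Qed.

(** The deviation [c - hi] is at least [c * e / 100] and so grows with [c], which makes Chebyshev's
    bound uniform in [c]. The factor 99/100 leaves room for triangles lost to heavy vertices. *)
Lemma dev_hi (c : R) : mu * (1 + 99 / 100 * e) <= c ->
  c / (2 * u * (c - hi) ^+ 2) <= 1 / 3.
Proof.
large; move=> hc; have := mu_gt0 => mu0; have hh := hi_le.
have c0 : 0 < c by apply: lt_le_trans hc; rewrite mulr_gt0 //; lra.
have muc : mu <= c by apply: le_trans hc; rewrite ler_peMr ?(ltW mu0) //; lra.
have dv : c * e <= 100 * (c - hi).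
  have h3 : hi * (1 + 99 / 100 * e) <= c * (1 + 3 / 4 * e).
    apply: (@le_trans _ _ (mu * (1 + 3 / 4 * e) * (1 + 99 / 100 * e))).
      by rewrite ler_wpM2r //; lra.
    by rewrite mulrAC ler_wpM2r //; lra.
  have h4 : c * e * (1 + 99 / 100 * e) <= 100 * (c - hi) * (1 + 99 / 100 * e).
    have ce0 : 0 <= c * e by rewrite mulr_ge0 // ltW.
    have : 0 <= c * e * (20 - e) by rewrite mulr_ge0 // subr_ge0.
    by lra.
  by rewrite ler_pM2r in h4 => //; lra.
have ce0 : 0 < c * e by rewrite mulr_gt0.
have dv0 : 0 < c - hi by lra.
rewrite ler_pdivrMr; last by rewrite !mulr_gt0 ?exprn_gt0.
have h3 : (c * e) ^+ 2 <= 100 * 100 * (c - hi) ^+ 2.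
  have := dv; rewrite -ler_sqr ?nnegrE ?mulr_ge0 ?(ltW c0) ?(ltW e0) ?(ltW dv0) //.
  by rewrite [(100 * _) ^+ 2]exprMn; lra.
have h4 : K * c <= 27 * (2 * u * (c * e) ^+ 2).
  apply: (@le_trans _ _ (2 * u * (27 * (e ^+ 2 * mu)) * c)).
    rewrite ler_pM2r //; apply: (le_trans u_ge).
    by rewrite ler_pM2l ?m_le // mulr_gt0.
  apply: (@le_trans _ _ (2 * u * (27 * (e ^+ 2 * c)) * c)); last first.
    by rewrite exprMn; lra.
  by rewrite ler_pM2r // !ler_pM2l ?mulr_gt0 ?exprn_gt0.
have h5 : 2 * u * (c * e) ^+ 2 <= 2 * u * (100 * 100 * (c - hi) ^+ 2).
  by rewrite ler_pM2l // mulr_gt0.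
have h6 : 1000 * 1000 * c <= K * c by rewrite ler_pM2r.
by lra.
Qed.

(** The hypothesis gives [b <= 4 m / (K d ^ 2)]. Cubing and using [m ^ 2 <= e ^ 4 d ^ 6], which
    follows from [x <= d], leaves [64 m e ^ 4 / K ^ 3]; the three factors [K] absorb [20 ^ 5]. *)
Lemma heavy_triangles (b : R) : b * (u * d ^+ 2) < 2 -> 0 <= b ->
  b ^+ 3 <= 6 / 100 * (e * mu).
Proof.
case: (H) => x0 e0 e20 mE _ _ xd d1 K_ge u0 _ _ _ _ _ _ _ hb b0.
have m0 : 0 < m := m_gt0.
have K0 : 0 < K by lra.
have d0 : 0 < d := lt_le_trans ltr01 d1.
have g1 : b * K * d ^+ 2 <= 4 * m.
  apply: (@le_trans _ _ (b * (2 * u * m) * d ^+ 2)).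
    by rewrite ler_wpM2r ?exprn_ge0 ?ler_wpM2l ?u_ge // ltW.
  rewrite (_ : _ * d ^+ 2 = b * (u * d ^+ 2) * (2 * m)); last by ring.
  rewrite (_ : 4 * m = 2 * (2 * m)); last by ring.
  by rewrite ler_pM2r ?mulr_gt0 // ltW.
have g2 : (b * K) ^+ 3 * d ^+ 6 <= 64 * m ^+ 3.
  rewrite (_ : 64 = 4 ^+ 3); last by ring.
  rewrite (_ : d ^+ 6 = (d ^+ 2) ^+ 3); last by rewrite -exprM.
  rewrite -!exprMn lerXn2r ?nnegrE //.
    by rewrite !mulr_ge0 ?exprn_ge0 // ltW.
  by rewrite mulr_ge0 // ltW.
have g3 : m ^+ 2 <= e ^+ 4 * d ^+ 6.
  rewrite mE exprMn -!exprM ler_pM2l ?exprn_gt0 //.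
  by rewrite lerXn2r ?nnegrE // ltW.
have g4 : (b * K) ^+ 3 <= 64 * (m * e ^+ 4).
  rewrite -(ler_pM2r (_ : 0 < d ^+ 6)) ?exprn_gt0 //; apply: (le_trans g2).
  rewrite -[leRHS]mulrA ler_pM2l // exprS -[leRHS]mulrA ler_pM2l //.
have g5 : m * e ^+ 4 <= 27 * 20 ^+ 5 * (e * mu).
  apply: (@le_trans _ _ (27 * (e ^+ 2 * mu) * e ^+ 4)).
    by rewrite ler_wpM2r ?m_le // exprn_ge0 // ltW.
  rewrite (_ : _ * e ^+ 4 = 27 * (e * mu) * e ^+ 5); last by ring.
  rewrite [leRHS]mulrAC; apply: ler_wpM2l.
    by rewrite ltW // !mulr_gt0 // mu_gt0.
  by rewrite lerXn2r ?nnegrE //; exact: ltW.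
have g8 : 0 < e * mu by rewrite mulr_gt0 // mu_gt0.
have b30 : 0 <= b ^+ 3 by rewrite exprn_ge0.
(* [K ^ 3] is removed one factor at a time, so that the final inequality is linear in the abstracted
   products. *)
have k1 : 1000 * 1000 * b ^+ 3 <= K * b ^+ 3 := ler_wpM2r b30 K_ge.
have t1 : 0 <= K * b ^+ 3 by rewrite mulr_ge0 // ltW.
have k2 : 1000 * 1000 * (K * b ^+ 3) <= K * (K * b ^+ 3) := ler_wpM2r t1 K_ge.
have t2 : 0 <= K * (K * b ^+ 3) by rewrite mulr_ge0 // ltW.
have k3 : 1000 * 1000 * (K * (K * b ^+ 3)) <= K * (K * (K * b ^+ 3)) :=
  ler_wpM2r t2 K_ge.
rewrite (_ : (b * K) ^+ 3 = K * (K * (K * b ^+ 3))) in g4; last by ring.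
move: (K * (K * (K * b ^+ 3))) k3 g4 => w3; move: (K * (K * b ^+ 3)) t2 k2 => w2.
move: (K * b ^+ 3) t1 k1 => w1; move: (b ^+ 3) b30 => w.
move: (e * mu) g8 g5 => y; move: (m * e ^+ 4) => z.
by clear => *; lra.
Qed.

End Large.

Section Small.
Hypotheses (Hm : m < 1) (He : e = 20).

Local Ltac small := setting; have := Hm; have := He => eE m1.

(** A nonzero count has [c <= c ^ 2]; from [hi <= 16 mu] and [21 mu <= c] the deviation is at least
    [5 c / 21]. *)
Lemma dev_hi_small (c : R) : 1 <= c -> mu * (1 + e) <= c ->
  c / (2 * u * (c - hi) ^+ 2) <= 1 / 3.
Proof.
small; move=> c1 hc; have hh := hi_le.
have c0 : 0 < c by lra.
rewrite eE in hc hh.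
have dv : 5 * c <= 21 * (c - hi) by lra.
have dv0 : 0 < c - hi by lra.
rewrite ler_pdivrMr; last by rewrite !mulr_gt0 ?exprn_gt0.
have h2 : 25 * (c * c) <= 441 * (c - hi) ^+ 2.
  have := dv; rewrite -ler_sqr ?nnegrE; [|by lra..].
  by rewrite !exprMn !expr2; lra.
have cc : c <= c * c by rewrite ler_peMr // ltW.
have uu : K <= 2 * u.
  by apply: le_trans uK _; rewrite mulrC ler_pM2r //; lra.
have h3 : K * c <= 2 * u * (c * c) by apply: ler_pM => //; lra.
have h4 : 2 * u * (25 * (c * c)) <= 2 * u * (441 * (c - hi) ^+ 2).
  by rewrite ler_pM2l // mulr_gt0.
have h5 : 1000 * 1000 * c <= K * c by rewrite ler_pM2r.
by lra.
Qed.

(** For [b] the number of heavy vertices, this means that there are none. *)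
Lemma heavy_small (b : R) : b * (u * d ^+ 2) < 2 -> 0 <= b -> b < 1.
Proof.
small; move=> hb b0; have [//|b1] := ltP b 1.
have uu : K <= 2 * u.
  by apply: le_trans uK _; rewrite mulrC ler_pM2r //; lra.
have : u * 1 <= b * (u * d ^+ 2).
  rewrite -[leLHS]mul1r; apply: ler_pM => //; rewrite ?mulr_ge0 ?(ltW u0) //.
  by rewrite ler_pM2l // expr_ge1 //; lra.
by lra.
Qed.

End Small.

End Numeric.

(** * The verdict under given integer parameters *)

Section TriangleTest.
Variables (R : realType) (n : nat) (G : sgraph n) (D : nat).
Hypotheses (n3 : (3 <= n)%N) (D0 : (0 < D)%N).

Let n0 : (0 < n)%N. Proof. exact: leq_trans n3. Qed.

Lemma rounds_deviation (phi : bool -> R) acc s (delta : R) : 0 < delta ->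
  (forall v, heavy G D v -> phi false <= 0) ->
  (forall y : nat, phi (acc y) <= 0 \/
     phi (acc y) <= 1 /\ delta <= `|y%:R - s%:R * smean R G D|) ->
  rounds G D phi acc s 0 <= 6 * (s%:R * smean R G D) / delta ^+ 2.
Proof.
move=> d0 hh hacc; have d20 : 0 < delta ^+ 2 by rewrite exprn_gt0.
apply: le_trans (@rounds_chebyshev R n G D n0 D0 phi acc (s%:R * smean R G D)
  (delta ^+ 2) s 0 d20 hh _) _; last first.
  by rewrite add0r subrr expr0n /= add0r mulrCA.
move=> y; case: (hacc y) => [h|[h1 h2]].
  by apply: le_trans h _; rewrite divr_ge0 ?sqr_ge0 // ltW.
apply: le_trans h1 _; rewrite ler_pdivlMr // mul1r -[leRHS]real_normK ?num_real //.
by rewrite lerXn2r ?nnegrE // ltW.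
Qed.

Lemma scaleE : (scale n)%:R = n%:R ^+ 16 :> R.
Proof. by rewrite /scale !natrM; ring. Qed.

Lemma bin3R : 'C(n, 3)%:R = n%:R * (n - 1)%N%:R * (n - 2)%N%:R / 6 :> R.
Proof.
apply: (mulIf (_ : 6 != 0)); first by rewrite pnatr_eq0.
by rewrite divfK ?pnatr_eq0 // -!natrM mulnC bin3 !subn1 subn2.
Qed.

Variables (P E s : nat).
Let N : R := (scale n)%:R.
Let p' : R := P%:R / N.
Let e' : R := E%:R / N.
Let mu' : R := 'C(n, 3)%:R * p' ^+ 3.
Let u : R := s%:R / (n%:R * D%:R ^+ 2).
Let hi : R := mu' * (1 + 3 / 4 * e').
Let lo : R := mu' * (1 - 3 / 4 * e').

Let nR : 0 < n%:R :> R. Proof. by rewrite ltr0n. Qed.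
Let DR : 0 < D%:R :> R. Proof. by rewrite ltr0n. Qed.
Let NR : 0 < N. Proof. by rewrite /N scaleE exprn_gt0. Qed.

Let c : R := (n - 1)%N%:R * (n - 2)%N%:R * s%:R * P%:R ^+ 3.
Let w : R := 2 * D%:R ^+ 2 * N ^+ 4.

Lemma w_gt0 : 0 < w.
Proof. by rewrite /w !mulr_gt0 ?exprn_gt0. Qed.

Lemma hi_scaled : 12 * u * hi * w = c * (4 * N + 3 * E%:R).
Proof.
rewrite /hi /mu' /p' /e' /u /w /c bin3R; field.
by rewrite !gt_eqF.
Qed.

Lemma lo_scaled : 12 * u * lo * w = c * (4 * N - 3 * E%:R).
Proof.
rewrite /lo /mu' /p' /e' /u /w /c bin3R; field.
by rewrite !gt_eqF.
Qed.

Lemma window_nat (a b y : nat) : ~~ ((a < y)%N + (y < b)%N != 0)%N = (b <= y <= a)%N.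
Proof. by case: (ltnP a y); case: (ltnP y b). Qed.

Lemma acceptsE z : accepts n P E D s z =
  (c * (4 * N - 3 * E%:R) <= z%:R * w) && (z%:R * w <= c * (4 * N + 3 * E%:R)).
Proof.
rewrite /accepts; set N4 := (scale n * scale n * _)%N.
set cn := ((n - 1) * (n - 2) * s * P * P * P)%N.
set x := (z * D * D * 2 * N4)%N.
have xE : x%:R = z%:R * w :> R.
  by rewrite /x /N4 /w /N; move: (scale n) => q; rewrite !natrM; ring.
have cE : cn%:R = c by rewrite /cn !natrM /c; ring.
have hE : (x <= cn * (4 * scale n + 3 * E))%N = (z%:R * w <= c * (4 * N + 3 * E%:R)).
  by rewrite -xE -cE -!natrM -natrD -natrM ler_nat.
(* If [3 E > 4 N], the truncated difference is 0 and the real threshold is not positive, so neither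
   excludes any total. *)
have lE : (cn * (4 * scale n - 3 * E) <= x)%N = (c * (4 * N - 3 * E%:R) <= z%:R * w).
  rewrite -xE -cE; case: (leqP (3 * E) (4 * scale n)) => h.
    by rewrite -!natrM -natrB // -natrM ler_nat.
  rewrite (eqP (ltnW h : _ - _ == 0)%N) muln0 leq0n; apply/esym.
  apply: (@le_trans _ _ 0) => //; rewrite mulr_ge0_le0 // subr_le0 -!natrM ler_nat ltnW //.
rewrite -lE -hE; exact: window_nat.
Qed.

Lemma accepts_lo z : accepts n P E D s z -> 12 * u * lo <= z%:R.
Proof.
by rewrite acceptsE => /andP[h _]; rewrite -(ler_pM2r w_gt0) lo_scaled.
Qed.

Lemma accepts_hi z : accepts n P E D s z -> z%:R <= 12 * u * hi.
Proof.
by rewrite acceptsE => /andP[_ h]; rewrite -(ler_pM2r w_gt0) hi_scaled.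
Qed.

Lemma accepts_out z : ~~ accepts n P E D s z ->
  z%:R < 12 * u * lo \/ 12 * u * hi < z%:R.
Proof.
rewrite acceptsE negb_and -!ltNge => /orP[] h; [left|right].
  by rewrite -(ltr_pM2r w_gt0) lo_scaled.
by rewrite -(ltr_pM2r w_gt0) hi_scaled.
Qed.

Lemma mean_scaled (H : nat) :
  n%:R * D%:R ^+ 2 * smean R G D = 12 * (C3 G)%:R - 2 * H%:R ->
  s%:R * smean R G D = 12 * u * ((C3 G)%:R - H%:R / 6).
Proof.
move=> h.
have -> : 12 * u * ((C3 G)%:R - H%:R / 6) = u * (12 * (C3 G)%:R - 2 * H%:R) by field.
rewrite -h /u; field.
by rewrite !gt_eqF.
Qed.

Lemma deviation_scaled (cc t : R) : 0 < u ->
  6 * (12 * u * cc) / (12 * u * t) ^+ 2 = cc / (2 * u * t ^+ 2).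
Proof.
move=> u0; have [->|t0] := eqVneq t 0; first by rewrite !expr2 !mulr0 invr0 !mulr0.
by field; rewrite t0 gt_eqF.
Qed.

Section Bounds.
Variables (p e K eta : R).
Let x : R := n%:R * p.
Let m : R := e ^+ 2 * x ^+ 3.
Let mu : R := 'C(n, 3)%:R * p ^+ 3.
Hypothesis Hset : numeric_setting x e m mu mu' e' u D%:R K eta.
Hypothesis m_small : m < 1 -> e = 20.
Hypothesis e'_20 : e = 20 -> e' = 20.
Hypothesis approx : 1 <= m -> (1 - eta) * mu <= mu' /\ e - eta <= e'.

Local Notation acc := (accepts n P E D s).
Local Notation pacc := (rounds G D (fun b => (b == true)%:R : R) acc s 0).
Local Notation prej := (rounds G D (fun b => (b == false)%:R : R) acc s 0).

(** Heavy vertices are avoided with probability at most [(1 - y) ^ s], where [s y >= 2]. Its product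
    with [(1 + y) ^ s] is at most 1, and the latter is at least 3 by Bernoulli's inequality. *)
Lemma pacc_heavy : 2 * n%:R <= s%:R * #|heavy_set G D|%:R :> R -> pacc <= 1 / 3.
Proof.
move=> h; apply: le_trans (@rounds_heavy R n G D n0 D0 acc s 0) _.
set y := _ / _.
have y1 : y <= 1.
  rewrite ler_pdivrMr // mul1r ler_nat.
  by apply: leq_trans (max_card _) _; rewrite card_ord.
have y0 : 0 <= y by rewrite divr_ge0.
have sy : 2 <= s%:R * y.
  by rewrite /y mulrA ler_pdivlMr.
have k1 : (1 - y) ^+ s * (1 + y) ^+ s <= 1.
  rewrite -exprMn exprn_ile1 //; first by rewrite mulr_ge0 //; lra.
  have : 0 <= y * y by rewrite mulr_ge0.
  by lra.
have k2 : 1 + s%:R * y <= (1 + y) ^+ s.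
  elim: (s) => [|s' IH]; first by rewrite mul0r addr0 expr0.
  rewrite exprS -[s'.+1]addn1 natrD; have : 0 <= s'%:R * (y * y) by rewrite !mulr_ge0.
  have : (1 + y) * (1 + s'%:R * y) <= (1 + y) * (1 + y) ^+ s'.
    by rewrite ler_wpM2l //; lra.
  by lra.
have k3 : 0 <= (1 - y) ^+ s by rewrite exprn_ge0 //; lra.
have : (1 - y) ^+ s * 3 <= (1 - y) ^+ s * (1 + y) ^+ s.
  by rewrite ler_wpM2l //; lra.
by lra.
Qed.

(** Few heavy vertices cannot hide enough triangles to bring a too large count into the window, and
    they only lower a too small one. *)
Lemma pacc_bad : mu * (1 + e) < (C3 G)%:R \/ (e < 1 /\ (C3 G)%:R < mu * (1 - e)) ->
  pacc <= 1 / 3.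
Proof.
move=> bad; have [|light] := lerP (2 * n%:R) (s%:R * #|heavy_set G D|%:R : R).
  exact: pacc_heavy.
have [H HE Hle] := smeanE R G n0 D0.
have hlight : #|heavy_set G D|%:R * (u * D%:R ^+ 2) < 2.
  have -> : #|heavy_set G D|%:R * (u * D%:R ^+ 2) = s%:R * #|heavy_set G D|%:R / n%:R.
    by rewrite /u; field; rewrite !gt_eqF.
  by rewrite ltr_pdivrMr.
have u0 := ns_u Hset; have u12 : 0 < 12 * u := mulr_gt0 (ltr0n _ 12) u0.
have mu0 := mu_gt0 Hset; have e0 := ns_e Hset.
have meanE := mean_scaled HE; set cc := _ - _ in meanE.
have Hle' : H%:R <= #|heavy_set G D|%:R ^+ 3 :> R by rewrite -natrX ler_nat.
have cC : cc <= (C3 G)%:R by rewrite /cc lerBlDr lerDl divr_ge0.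
have high : hi < cc -> cc / (2 * u * (cc - hi) ^+ 2) <= 1 / 3 -> pacc <= 1 / 3.
  move=> hc; apply: le_trans.
  have d0 : 0 < 12 * u * (cc - hi) by apply: mulr_gt0; rewrite ?subr_gt0.
  rewrite -deviation_scaled // -meanE; apply: rounds_deviation => // y.
  case E': (acc y); [right|by left].
  split=> //; have := accepts_hi E'; rewrite meanE => yh.
  rewrite distrC ger0_norm ?subr_ge0.
    by rewrite mulrBr lerB.
  by apply: le_trans yh _; rewrite ler_pM2l // ltW.
case: bad => [bad|[e1 bad]].
- have [m1|m1] := ltP m 1.
    have b0 : #|heavy_set G D|%:R < 1 :> R.
      exact: (heavy_small Hset m1 (m_small m1) hlight (ler0n _ _)).
    have H0 : H%:R = 0 :> R.
      rewrite ltrn1 in b0; apply/eqP; rewrite pnatr_eq0 -leqn0.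
      by move: Hle; rewrite (_ : #|_| = 0)%N //; apply/eqP; rewrite -leqn0 -ltnS.
    have ccE : cc = (C3 G)%:R by rewrite /cc H0 mul0r subr0.
    have C1 : 1 <= (C3 G)%:R :> R.
      rewrite ler1n -(ltr0n R); apply: le_lt_trans bad.
      by rewrite mulr_ge0 ?(ltW mu0) //; lra.
    apply: high; last by apply: (dev_hi_small Hset m1 (m_small m1)); rewrite ccE // ltW.
    apply: (le_lt_trans (hi_le Hset)); rewrite ccE; apply: le_lt_trans bad.
    by rewrite ler_pM2l //; lra.
  have [a1 a2] := approx m1.
  have hv := heavy_triangles Hset m1 a1 a2 hlight (ler0n _ _).
  have cc_ge : mu * (1 + 99 / 100 * e) <= cc by rewrite /cc; lra.
  apply: high; last exact: (dev_hi Hset m1 a1 a2 cc_ge).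
  apply: (le_lt_trans (hi_le Hset)); apply: lt_le_trans cc_ge.
  by rewrite ltr_pM2l //; lra.
- have [m1|m1] := ltP m 1.
    by have := m_small m1; lra.
  have [a1 a2] := approx m1.
  have lg := lo_ge Hset m1 a1 a2 e1.
  pose t := 1 / 5 * e.
  have t0 : 0 < t * mu by rewrite mulr_gt0 // /t; lra.
  have cc0 : 0 <= cc.
    rewrite -(pmulr_rge0 _ u12) -meanE.
    by rewrite mulr_ge0 // smean_ge0.
  apply: (@le_trans _ _ (cc / (2 * u * (t * mu) ^+ 2))); last first.
    apply: le_trans (dev_mu Hset m1 a1 a2 _ _) _; rewrite ?lexx ?cc0 /=; try by lra.
    have : 0 <= mu * e by rewrite mulr_ge0 // ltW.
    by lra.
  have d0 : 0 < 12 * u * (t * mu) by apply: mulr_gt0.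
  rewrite -deviation_scaled // -meanE; apply: rounds_deviation => // y.
  case E': (acc y); [right|by left].
  split=> //; have := accepts_lo E'; rewrite meanE => yl.
  have hcl : cc + t * mu <= lo.
    apply: le_trans lg; rewrite /t.
    have : 0 <= mu * e by rewrite mulr_ge0 // ltW.
    by lra.
  have : 12 * u * (cc + t * mu) <= 12 * u * lo by rewrite ler_pM2l.
  rewrite mulrDr => h1; rewrite ger0_norm; last by lra.
  by lra.
Qed.

Lemma prej_good : (forall v, ~~ heavy G D v) ->
  mu * (1 - e / 2) <= (C3 G)%:R <= mu * (1 + e / 2) -> prej <= 1 / 100.
Proof.
move=> light /andP[Clo Chi].
have [H HE Hle] := smeanE R G n0 D0.
have u0 := ns_u Hset; have u12 : 0 < 12 * u := mulr_gt0 (ltr0n _ 12) u0.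
have mu0 := mu_gt0 Hset; have e0 := ns_e Hset.
have H0 : H = 0%N.
  apply/eqP; rewrite -leqn0; apply: leq_trans Hle _.
  rewrite (_ : heavy_set G D = finset.set0) ?cards0 //.
  by apply/setP => v; rewrite !inE; apply/negbTE.
have meanE := mean_scaled HE.
rewrite H0 mul0r subr0 in meanE.
have hnot v : heavy G D v -> (false == false)%:R <= 0 :> R.
  by move=> hv; have := light v; rewrite hv.
have [m1|m1] := ltP m 1.
  (* Here [11 mu < 1], so a graph in the window has no triangle and its mean total is 0. A total of
     0 is accepted because [e' = 20] exactly, which puts the lower edge at or below 0. *)
  have e20 := m_small m1.
  have C0 : (C3 G)%:R = 0 :> R.
    apply/eqP; rewrite pnatr_eq0 -leqn0 -ltnS -(ltr_nat R).
    apply: le_lt_trans Chi _; have := m1; rewrite /m e20 => m1'.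
    by have := ns_mu_le Hset; rewrite -/mu; lra.
  apply: le_trans (rounds_deviation (delta := 1) ltr01 hnot _) _; last first.
    by rewrite meanE C0 !mulr0 mul0r; lra.
  move=> y; rewrite meanE C0 mulr0 subr0.
  case: y => [|y]; last by right; rewrite normr_nat ler1n; split=> //; case: acc.
  left; case E': (acc 0%N) => //; move/negbT: E' => /accepts_out[].
    rewrite ltNge => /negP[]; rewrite pmulr_rle0 //.
    rewrite /lo (e'_20 e20) mulr_ge0_le0 ?(ns_mu'_ge0 Hset) //; lra.
  rewrite ltNge => /negP[]; rewrite pmulr_rge0 //.
  by rewrite /hi mulr_ge0 ?(ns_mu'_ge0 Hset) //; have := ns_e'_ge0 Hset; lra.
have [a1 a2] := approx m1.
have hg := hi_ge Hset m1 a1 a2; have ll := lo_le Hset m1 a1 a2.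
have mue : 0 < mu * e by rewrite mulr_gt0.
pose t := 1 / 5 * e.
have t0 : 0 < t * mu by rewrite mulr_gt0 // /t; lra.
have Cm : (0 : R) <= ((C3 G)%:R : R) <= 11 * mu.
  have : 0 <= mu * (20 - e) by rewrite mulr_ge0 ?(ltW mu0) // subr_ge0 (ns_e20 Hset).
  move=> h; apply/andP; split; first exact: ler0n.
  by lra.
apply: le_trans (dev_mu Hset m1 a1 a2 Cm (lexx t)).
have d0 : 0 < 12 * u * (t * mu) by apply: mulr_gt0.
rewrite -deviation_scaled // -meanE; apply: rounds_deviation => // y.
case E': (acc y); [by left|right]; split=> //.
rewrite meanE; move/negbT: E' => /accepts_out[] yb.
  have : 12 * u * lo <= 12 * u * ((C3 G)%:R - t * mu).
    by rewrite ler_pM2l //; apply: (le_trans ll); rewrite /t; lra.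
  rewrite mulrBr => h1; rewrite distrC ger0_norm; lra.
have : 12 * u * ((C3 G)%:R + t * mu) <= 12 * u * hi.
  by rewrite ler_pM2l //; apply: le_trans hg; rewrite /t; lra.
rewrite mulrDr => h1; rewrite ger0_norm; lra.
Qed.

End Bounds.
End TriangleTest.

(** * Choice of the parameters *)

Lemma out_prob_computes (R : realType) n W (G : sgraph n) s0 b T (v : R) :
  computes W G s0 (fun b' => (b' == b)%:R) T s0 v ->
  out_prob R (@QAlg n (seq cmd * mem)%type s0 (@ram_next n W)) G b = v.
Proof.
move=> [h _]; apply: norm_lim_near_cst.
by exists T => // t /= Tt; apply: h.
Qed.

Lemma exp_time_computes (R : realType) n W (G : sgraph n) s0 phi T (v : R) :
  computes W G s0 phi T s0 v ->
  (exp_time R (@QAlg n (seq cmd * mem)%type s0 (@ram_next n W)) G <= T%:R%:E)%E.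
Proof.
move=> [_ h]; apply: lime_le; last by apply: nearW => t; rewrite lee_fin; apply: h.
apply: ereal_nondecreasing_is_cvgn => t1 t2 t12; rewrite lee_fin.
exact: erun_nondecreasing.
Qed.

Lemma exp_queries_le_time (R : realType) n (A : qalg n) (G : sgraph n) :
  (exp_queries R A G <= exp_time R A G)%E.
Proof.
have c1 : cvgn (fun t => (erun G (fun a => (is_query a)%:R : R) (fun=> 0) t (qinit A))%:E).
  apply: ereal_nondecreasing_is_cvgn => t1 t2 t12; rewrite lee_fin.
  by apply: erun_nondecreasing.
have c2 : cvgn (fun t => (erun G (fun=> 1 : R) (fun=> 1) t (qinit A))%:E).
  apply: ereal_nondecreasing_is_cvgn => t1 t2 t12; rewrite lee_fin.
  by apply: erun_nondecreasing.
apply: lee_lim => //; apply: nearW => t; rewrite lee_fin.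
by apply: erun_le => // a; case: (is_query a).
Qed.

Lemma expR_half_le2 (R : realType) : expR (1 / 2) <= 2 :> R.
Proof.
have h : 1 / 2 <= (expR (1 / 2))^-1 :> R.
  by rewrite -expRN; apply: le_trans (expR_ge1Dx _); lra.
have g0 := expR_gt0 (1 / 2 : R).
by rewrite -[leRHS]invrK -lef_pV2 ?posrE ?invr_gt0 // invrK; lra.
Qed.

Lemma expR1_le4 (R : realType) : expR 1 <= 4 :> R.
Proof.
have -> : expR 1 = expR (1 / 2) ^+ 2 :> R by rewrite -expRM_natl; congr expR; lra.
have -> : 4 = 2 ^+ 2 :> R by ring.
by rewrite lerXn2r ?nnegrE ?expR_half_le2 // expR_ge0.
Qed.

Lemma log2_le_ln (R : realType) n L : (0 < n)%N -> (2 ^ L <= 2 * n)%N ->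
  L%:R <= 1 + 2 * ln n%:R :> R.
Proof.
move=> n0; case: L => [|L]; first by move=> _; rewrite addr_ge0 // mulr_ge0 // ln_ge0 // ler1n.
rewrite expnS leq_mul2l /= => h.
have h1 : L%:R * ln 2 <= ln n%:R :> R.
  have n0R : 0 < n%:R :> R by rewrite ltr0n.
  rewrite mulr_natl -lnXn // ler_ln ?posrE ?exprn_gt0 //.
  by rewrite -natrX ler_nat.
have h2 : 1 / 2 <= ln 2 :> R.
  have := expR_half_le2 R.
  by rewrite -ler_ln ?posrE ?expR_gt0 // expRK.
have : L%:R * (1 / 2) <= L%:R * ln 2 :> R by rewrite ler_wpM2l.
by rewrite -[L.+1%:R]natr1; lra.
Qed.

Lemma rounds_ge0 (R : realType) n (G : sgraph n) D (phi : bool -> R) acc r z :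
  (forall b, 0 <= phi b) -> 0 <= rounds G D phi acc r z.
Proof.
move=> phi0; elim: r z => [|r IH] z /=; first exact: phi0.
rewrite mulr_ge0 ?invr_ge0 // sumr_ge0 // => v _; case: ifP => _ //.
rewrite mulr_ge0 ?invr_ge0 // sumr_ge0 // => i _.
by rewrite mulr_ge0 ?invr_ge0 // sumr_ge0.
Qed.

(** If [k p < 1], then [d <= 16 lam] and [k <= 1 / p]. Otherwise [d <= 16 lam k p], and dividing by
    [q] leaves a multiple of [lam ^ 2 / (e ^ 2 p)], where [1 / e <= lam]. *)
Lemma samples_le (R : realFieldType) (K k p d q lam e : R) :
  0 < K -> 0 < k -> 0 < p -> 0 <= d -> d <= 2 * (k * p) + 14 * lam ->
  1 <= lam -> 1 <= lam * e -> 1 <= q ->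
  (1 <= k * p -> e ^+ 2 * (k * p) ^+ 3 / 8 <= q) ->
  K * k * d ^+ 2 / q <= 8 * 16 ^+ 2 * K * (p^-1 * lam ^+ 4).
Proof.
move=> K0 k0 p0 d0 hd lam1 le1 q1 hq.
have q0 : 0 < q by lra.
have lam0 : 0 < lam by lra.
have ip0 : 0 < p^-1 by rewrite invr_gt0.
have lam24 : lam ^+ 2 <= lam ^+ 4 by rewrite ler_weXn2l.
have Kp0 : 0 < K * p^-1 by rewrite mulr_gt0.
have t0 : 0 <= K * p^-1 * lam ^+ 4 by rewrite mulr_ge0 ?exprn_ge0 // ltW.
have Kk0 : 0 < K * k by rewrite mulr_gt0.
rewrite ler_pdivrMr //; have [x1|x1] := ltP (k * p) 1.
  clear hq; have D16 : d ^+ 2 <= (16 * lam) ^+ 2.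
    by rewrite lerXn2r ?nnegrE ?mulr_ge0 ?(ltW lam0) //; lra.
  have np : k <= p^-1 by rewrite -[p^-1]mul1r ler_pdivlMr // ltW.
  apply: (@le_trans _ _ (K * p^-1 * (16 * lam) ^+ 2)).
    by apply: ler_pM; rewrite ?exprn_ge0 ?(ltW Kk0) // ler_pM2l.
  have t1 : K * p^-1 * lam ^+ 2 <= K * p^-1 * lam ^+ 4 by rewrite ler_pM2l.
  have : K * p^-1 * lam ^+ 4 * 1 <= K * p^-1 * lam ^+ 4 * q by rewrite ler_wpM2l.
  by rewrite exprMn; lra.
have {hq}hq := hq x1; have kp0 : 0 < k * p by rewrite mulr_gt0.
have D16 : d ^+ 2 <= (16 * (lam * (k * p))) ^+ 2.
  have lx : lam <= lam * (k * p) by rewrite ler_peMr // ltW.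
  have xl : k * p <= lam * (k * p) by rewrite ler_peMl // ltW.
  rewrite lerXn2r ?nnegrE //; last by lra.
  by rewrite !mulr_ge0 // ltW.
apply: (@le_trans _ _ (K * k * (16 * (lam * (k * p))) ^+ 2)).
  by rewrite ler_wpM2l // ltW.
apply: (@le_trans _ _ (8 * 16 ^+ 2 * K * (p^-1 * lam ^+ 4) *
   (e ^+ 2 * (k * p) ^+ 3 / 8))); last first.
  rewrite ler_wpM2l // (_ : 8 * 16 ^+ 2 * K * (p^-1 * lam ^+ 4) =
    8 * 16 ^+ 2 * (K * p^-1 * lam ^+ 4)); last by ring.
  by rewrite mulr_ge0 // mulr_ge0 // exprn_ge0.
have -> : 8 * 16 ^+ 2 * K * (p^-1 * lam ^+ 4) * (e ^+ 2 * (k * p) ^+ 3 / 8) =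
   K * k * (16 * (lam * (k * p))) ^+ 2 * (lam * e) ^+ 2.
  by field; rewrite gt_eqF.
rewrite ler_peMr //; last by rewrite exprn_ege1.
by rewrite mulr_ge0 ?(ltW Kk0) // exprn_ge0 // !mulr_ge0 // ltW.
Qed.

Lemma time_natr (R : realFieldType) (a b : nat) :
  (3 * a + 28 * b + 64)%N%:R = 3 * a%:R + 28 * b%:R + 64 :> R.
Proof. by rewrite natrD natrD natrM natrM. Qed.

(** * Rounding of the inputs, and the resulting parameters *)

Section Choices.
Variables (R : realType) (n : nat) (p eps : R).
Hypothesis rng : in_range (100 * 100) n p eps.

Let W := (n ^ word_exp)%N.
Let N : R := (scale n)%:R.
Let P := fixpt n W 16 p.
Let E := cap20 n (fixpt n W 16 eps).
Let e := Num.min eps 20.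
Let p' : R := P%:R / N.
Let e' : R := E%:R / N.
Let x : R := n%:R * p.
Let m : R := e ^+ 2 * x ^+ 3.
Let mu : R := 'C(n, 3)%:R * p ^+ 3.
Let mu' : R := 'C(n, 3)%:R * p' ^+ 3.
Let eta : R := 24 / n%:R ^+ 15.

Lemma par_n3 : (3 <= n)%N. Proof. by case: rng. Qed.
Lemma par_n0 : (0 < n)%N. Proof. exact: leq_trans par_n3. Qed.
Lemma par_n0R : 0 < n%:R :> R. Proof. by rewrite ltr0n par_n0. Qed.
Lemma par_n3R : 3 <= n%:R :> R. Proof. by rewrite ler_nat par_n3. Qed.
Lemma par_C0 : 0 < 100 * 100 :> R. Proof. by rewrite mulr_gt0. Qed.
Lemma par_p0 : 0 < p. Proof. exact: in_range_p_gt0 par_C0 rng. Qed.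
Lemma par_p1 : p <= 1. Proof. by case: rng. Qed.
Lemma par_eps0 : 0 < eps. Proof. by case: rng. Qed.
Lemma par_N : N = n%:R ^+ 16. Proof. exact: scaleE. Qed.
Lemma par_N0 : 0 < N. Proof. by rewrite par_N exprn_gt0 // par_n0R. Qed.
Lemma par_scale : scale n = (n ^ 16)%N.
Proof. by rewrite /scale !mulnn -!expnM. Qed.
Lemma par_e0 : 0 < e. Proof. by rewrite lt_min par_eps0 ltr0n. Qed.
Lemma par_e20 : e <= 20. Proof. by rewrite ge_min lexx orbT. Qed.
Lemma par_x0 : 0 < x. Proof. exact: mulr_gt0 par_n0R par_p0. Qed.

Lemma par_P : P%:R <= p * N < P%:R + 1 /\ (P <= n ^ 16)%N.
Proof.
have pN0 : 0 <= p * n%:R ^+ 16 by rewrite -par_N mulr_ge0 // ltW // ?par_p0 ?par_N0.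
have /andP[h1 h2] := truncn_itv pN0.
have tle : (Num.truncn (p * n%:R ^+ 16) <= n ^ 16)%N.
  rewrite -(ler_nat R) natrX; apply: le_trans h1 _.
  by rewrite ger_pMl ?par_p1 // exprn_gt0 // par_n0R.
have PE : P = Num.truncn (p * n%:R ^+ 16).
  rewrite /P /fixpt; apply/minn_idPr; rewrite -ltnS prednK ?expn_gt0 ?par_n0 //.
  apply: leq_ltn_trans tle _; rewrite ltn_exp2l //.
  exact: leq_trans par_n3.
by rewrite PE par_N h1 -natr1 in h2 *.
Qed.

(** [eps] may exceed the largest word, but [20 * scale n] lies far below it, so the cut-off does not
    affect the minimum. When the cap applies, it is exact. *)
Lemma par_E : [/\ 0 <= e', e' <= e, e - N^-1 <= e' & e = 20 -> e' = 20].
Proof.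
have N0 := par_N0.
have eN0 : 0 <= eps * n%:R ^+ 16 by rewrite -par_N mulr_ge0 // ltW // ?par_eps0 ?par_N0.
have /andP[h1 h2] := truncn_itv eN0.
set t := Num.truncn _ in h1 h2.
have EE : E = minn (20 * scale n) t.
  rewrite /E /cap20 -minnE /fixpt minnA; congr minn; apply/minn_idPl.
  rewrite -ltnS prednK ?expn_gt0 ?par_n0 // par_scale.
  apply: (@leq_ltn_trans (n ^ (3 + 16))); last first.
    by rewrite ltn_exp2l //; exact: leq_trans par_n3.
  rewrite expnD leq_mul2r; apply/orP; right.
  by apply: (@leq_trans (3 ^ 3)); rewrite // leq_exp2r // par_n3.
rewrite -natr1 -par_N in h1 h2.
have e'0 : 0 <= e' by rewrite divr_ge0 // ltW.
have [big|small] := lerP 20 eps.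
  have eE : e = 20 by apply/min_idPr.
  have Et : E = (20 * scale n)%N.
    rewrite EE; apply/minn_idPl; rewrite -ltnS -(ltr_nat R) -natr1 natrM.
    by apply: le_lt_trans h2; rewrite ler_pM2r.
  have e'E : e' = 20 by rewrite /e' Et natrM mulfK // gt_eqF.
  by split=> //; rewrite e'E eE // gerBl invr_ge0 ltW.
have eE : e = eps by apply/min_idPl; rewrite ltW.
have Et : E = t.
  rewrite EE; apply/minn_idPr; rewrite -(ler_nat R) natrM.
  by apply: le_trans h1 _; rewrite ler_pM2r // ltW.
split=> //.
- by rewrite eE /e' Et ler_pdivrMr.
- rewrite eE /e' Et ler_pdivlMr // mulrBl mulVf ?gt_eqF //.
  by rewrite lerBlDr ltW.
- by rewrite eE => eq; move: small; rewrite eq ltxx.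
Qed.

Lemma par_p' : [/\ 0 <= p', p' <= p & p - N^-1 <= p'].
Proof.
have N0 := par_N0; have [/andP[h1 h2] _] := par_P.
split; first by rewrite divr_ge0 // ltW.
  by rewrite /p' ler_pdivrMr.
by rewrite /p' ler_pdivlMr // mulrBl mulVf ?gt_eqF // lerBlDr ltW.
Qed.

(** [C0 <= eps ^ 2 n p <= eps ^ 2 n] rules out [eps < 1 / n], so [e] stays far above the resolution
    [n ^- 16]. *)
Lemma par_en : 1 <= e * n%:R.
Proof.
have n3 := par_n3R.
have [big|small] := lerP 20 eps.
  have -> : e = 20 by apply/min_idPr.
  by lra.
have -> : e = eps by apply/min_idPl; rewrite ltW.
have h := in_range_np rng.
have e0 := par_eps0.
have h2 : eps ^+ 2 * (n%:R * p) <= eps ^+ 2 * n%:R.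
  by rewrite ler_wpM2l ?exprn_ge0 ?(ltW e0) // ler_piMr ?par_p1 // ltW // par_n0R.
have h3 : eps ^+ 2 * n%:R <= (eps * n%:R) ^+ 2.
  by rewrite exprMn ler_wpM2l ?exprn_ge0 ?(ltW e0) // expr2 ler_peMr; lra.
have en0 : 0 <= eps * n%:R by rewrite mulr_ge0 // ltW.
rewrite leNgt; apply/negP => lt1.
have : (eps * n%:R) ^+ 2 <= 1 by rewrite exprn_ile1 // ltW.
by lra.
Qed.

Lemma par_eta : 400 * eta <= e.
Proof.
have n0 := par_n0R; have n3 := par_n3R; have en := par_en.
have h : 400 * eta * n%:R <= 1.
  rewrite /eta (_ : 400 * (24 / n%:R ^+ 15) * n%:R = 9600 / n%:R ^+ 14); last first.
    by field; rewrite gt_eqF.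
  rewrite ler_pdivrMr ?exprn_gt0 // mul1r.
  have h2 : 9 <= n%:R ^+ 2 :> R.
    by rewrite (_ : 9 = 3 ^+ 2); [rewrite lerXn2r ?nnegrE // ltW | ring].
  (* [n >= 3] is enough, since [9 ^ 5 = 59049] exceeds 9600. *)
  have h10 : 9 ^+ 5 <= n%:R ^+ 10 :> R.
    have -> : n%:R ^+ 10 = (n%:R ^+ 2) ^+ 5 :> R by rewrite -exprM.
    by rewrite lerXn2r ?nnegrE ?exprn_ge0 // ltW.
  have h14 : n%:R ^+ 10 <= n%:R ^+ 14 :> R by rewrite ler_weXn2l //; lra.
  by apply: le_trans h14; apply: le_trans h10; lra.
by rewrite -(ler_pM2r n0); apply: le_trans h en.
Qed.

Lemma par_small : m < 1 -> e = 20.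
Proof.
move=> m1; have [big|small] := lerP 20 eps; first by apply/min_idPr.
exfalso; have e0 := par_eps0; have x0 := par_x0.
have eE : e = eps by apply/min_idPl; rewrite ltW.
have h := in_range_np rng; rewrite -/x in h.
have ee : eps ^+ 2 <= 400.
  by rewrite (_ : 400 = 20 ^+ 2); [rewrite lerXn2r ?nnegrE // ltW | ring].
have x25 : 25 <= x.
  have : eps ^+ 2 * x <= 400 * x by rewrite ler_wpM2r // ltW.
  by lra.
have : 100 * 100 <= m.
  rewrite /m eE exprS mulrA; apply: (le_trans h); rewrite ler_peMr //; last first.
    by rewrite -[1]mulr1; apply: ler_pM => //; lra.
  by rewrite mulr_ge0 ?exprn_ge0 // ltW.
by lra.
Qed.

(** [m >= 1] and [e <= 20] force [x >= 1 / 8], so truncation changes [p] by a relative error of at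
    most [8 / n ^ 15]; the cube triples it, whence [eta]. *)
Lemma par_approx3 : 1 <= m -> (1 - eta) * p ^+ 3 <= p' ^+ 3.
Proof.
move=> m1; have n0 := par_n0R; have n3 := par_n3R; have x0 := par_x0.
have p0 := par_p0; have [p'0 p'p pp'] := par_p'.
have x8 : 1 <= 8 * x.
  rewrite leNgt; apply/negP => x8.
  have : (8 * x) ^+ 3 <= 1 by rewrite exprn_ile1 ?mulr_ge0 // ltW.
  rewrite exprMn => h.
  have ee : e ^+ 2 <= 400.
    rewrite (_ : 400 = 20 ^+ 2); last by ring.
    by rewrite lerXn2r ?nnegrE ?par_e20 // ltW // par_e0.
  have : m <= 400 * x ^+ 3 by rewrite /m ler_wpM2r // exprn_ge0 // ltW.
  by lra.
pose t : R := 8 / n%:R ^+ 15.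
have n15 : 0 < n%:R ^+ 15 :> R by rewrite exprn_gt0.
have Nt : N^-1 <= t * p.
  rewrite par_N /t exprSr invfM mulrAC [8 * p]mulrC ler_pdivlMr //.
  rewrite mulrAC mulVf ?gt_eqF // mul1r.
  by rewrite -(ler_pM2r n0) mulVf ?gt_eqF //; move: x8; rewrite /x; lra.
have t0 : 0 <= t by rewrite divr_ge0 // ltW.
have t1 : t <= 1.
  rewrite /t ler_pdivrMr // mul1r.
  have : n%:R ^+ 2 <= n%:R ^+ 15 :> R by rewrite ler_weXn2l //; lra.
  have : 3 ^+ 2 <= n%:R ^+ 2 :> R by rewrite lerXn2r ?nnegrE // ltW.
  by lra.
have h1 : (1 - t) * p <= p' by lra.
have h2 : ((1 - t) * p) ^+ 3 <= p' ^+ 3.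
  by rewrite lerXn2r ?nnegrE // mulr_ge0 ?(ltW p0) // subr_ge0.
apply: le_trans h2; rewrite exprMn ler_wpM2r ?exprn_ge0 ?(ltW p0) //.
have -> : eta = 3 * t by rewrite /eta /t; field; rewrite gt_eqF.
have : 0 <= t ^+ 2 * (3 - t) by rewrite mulr_ge0 ?sqr_ge0 //; lra.
have -> : (1 - t) ^+ 3 = 1 - 3 * t + t ^+ 2 * (3 - t) by ring.
by lra.
Qed.

Lemma par_approx : 1 <= m -> (1 - eta) * mu <= mu' /\ e - eta <= e'.
Proof.
move=> m1; split.
  rewrite /mu /mu' mulrCA ler_wpM2l //; exact: par_approx3.
have [_ _ h _] := par_E; apply: le_trans h; rewrite lerD2l lerN2 par_N /eta.
have n0 := par_n0R.
rewrite -div1r ler_pdivrMr ?exprn_gt0 // [n%:R ^+ 16]exprSr mulrA.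
rewrite divfK ?gt_eqF ?exprn_gt0 //.
by have := par_n3R; lra.
Qed.

Variable L : nat.
Hypothesis nL : (n < 2 ^ L <= 2 * n)%N.
Let D := degree_cap n P L.
Let s := num_samples n P E D.
Let K : R := 32 * 32 * (32 * 32).
Let u : R := s%:R / (n%:R * D%:R ^+ 2).

Lemma par_D0 : (0 < D)%N.
Proof. by rewrite /D /degree_cap addn_gt0 orbT. Qed.

(** One unit is lost to the division, at most one more to the truncation of [p]. *)
Lemma par_y : let y := (P * n %/ scale n)%N in
  y%:R <= x /\ x <= y%:R + 2.
Proof.
move=> y; have N0 := par_N0; have n0 := par_n0R; have [p'0 p'p pp'] := par_p'.
have S0 : (0 < scale n)%N by rewrite -(ltr0n R).
have E1 : n%:R * p' = (P * n)%N%:R / N by rewrite /p' natrM mulrCA mulrA.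
have y1 : y%:R <= n%:R * p'.
  by rewrite E1 ler_pdivlMr // -natrM ler_nat leq_divM.
have y2 : n%:R * p' <= y%:R + 1.
  by rewrite E1 ler_pdivrMr // natr1 -natrM ler_nat ltnW // ltn_ceil.
have h1 : n%:R * p' <= x by rewrite ler_pM2l.
have h2 : x <= n%:R * p' + 1.
  have : n%:R * (p - N^-1) <= n%:R * p' by rewrite ler_pM2l.
  have : n%:R / N <= 1.
    rewrite ler_pdivrMr // mul1r par_N -[leLHS]expr1 ler_weXn2l //.
    by have := par_n3R; lra.
  by rewrite mulrBr -/x; lra.
by split; lra.
Qed.

Lemma par_D : x <= D%:R /\ D%:R <= 2 * x + L%:R + 12.
Proof.
have [y1 y2] := par_y; rewrite /D /degree_cap !natrD natrM.
have x0 := par_x0; have : 0 <= L%:R :> R by [].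
move: (_ %/ _)%N%:R y1 y2 => y y1 y2.
by split; lra.
Qed.

Let q : R := (P * n * (P * n) * (P * n) * (E * E) %/
   (scale n * scale n * (scale n * scale n) * scale n) + 1)%N%:R.
Let m' : R := e' ^+ 2 * (n%:R * p') ^+ 3.

Lemma par_q : m' <= q <= m' + 1.
Proof.
have N0 := par_N0; have S0 : (0 < scale n)%N by rewrite -(ltr0n R).
rewrite /q; set Y := (P * n * _ * _ * _)%N; set Z := (_ * scale n)%N.
have Z0 : (0 < Z)%N.
  by rewrite /Z; move: (scale n) S0 => k k0; rewrite !muln_gt0 k0.
have Z0R : 0 < Z%:R :> R by rewrite ltr0n.
have ZE : Z%:R = N ^+ 5 by rewrite /Z /N; move: (scale n) => k; rewrite !natrM; ring.
have -> : m' = Y%:R / Z%:R.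
  rewrite ZE /m' /p' /e' /Y !natrM; field; rewrite gt_eqF //.
rewrite natrD ler_pdivrMr // -natrD -natrM ler_nat addn1 ltnW ?ltn_ceil //=.
by rewrite -natr1 lerD2r ler_pdivlMr // -natrM ler_nat leq_divM.
Qed.

Lemma par_q1 : 1 <= q.
Proof. by rewrite /q ler1n addn1. Qed.

Lemma par_s : K * n%:R * D%:R ^+ 2 <= s%:R * q /\
  s%:R <= K * n%:R * D%:R ^+ 2 / q + 1.
Proof.
have q1 := par_q1; have q0 : 0 < q by lra.
rewrite /s /num_samples -/D; set A := (_ * D * D)%N.
have AE : K * n%:R * D%:R ^+ 2 = A%:R by rewrite /A !natrM /K; ring.
rewrite AE; move: q1 q0; rewrite /q; set qq := (_ + 1)%N => q1 q0.
have qq0 : (0 < qq)%N by rewrite /qq addn1.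
split; first by rewrite -natrM ler_nat addn1 ltnW // ltn_ceil.
by rewrite natrD lerD2r ler_pdivlMr // -natrM ler_nat leq_divM.
Qed.

Lemma par_m' : m' <= m.
Proof.
have [p'0 p'p _] := par_p'; have [e'0 e'e _ _] := par_E; have n0 := par_n0R.
have np'0 : 0 <= n%:R * p' := mulr_ge0 (ltW n0) p'0.
have np0 : 0 <= n%:R * p := mulr_ge0 (ltW n0) (ltW par_p0).
rewrite /m' /m /x; apply: ler_pM; [exact: exprn_ge0 | exact: exprn_ge0 | |].
  by rewrite lerXn2r ?nnegrE // ltW // par_e0.
rewrite lerXn2r ?nnegrE //.
by rewrite ler_wpM2l // ltW.
Qed.

Lemma par_setting : numeric_setting x e m mu mu' e' u D%:R K eta.
Proof.
have n0 := par_n0R; have p0 := par_p0; have [p'0 p'p _] := par_p'.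
have [e'0 e'e _ _] := par_E; have D0 : 0 < D%:R :> R by rewrite ltr0n par_D0.
have C0 : 0 <= 'C(n, 3)%:R :> R by [].
have nD0 : 0 < n%:R * D%:R ^+ 2 :> R by rewrite mulr_gt0 ?exprn_gt0.
have s0 : 0 < s%:R :> R by rewrite ltr0n /s /num_samples addn1.
split=> //.
- exact: par_x0.
- exact: par_e0.
- exact: par_e20.
- rewrite /mu mulrA /x exprMn ler_wpM2r ?exprn_ge0 ?(ltW p0) //.
  by rewrite -natrX -natrM ler_nat bin3_ge // par_n3.
- rewrite /mu mulrA /x exprMn ler_wpM2r ?exprn_ge0 ?(ltW p0) //.
  rewrite -natrX -natrM ler_nat bin3 !expnS expn0 muln1 mulnA.
  by rewrite !leq_mul // ?leq_pred // (leq_trans (leq_pred _)) ?leq_pred.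
- by have [] := par_D.
- by rewrite ler1n par_D0.
- by rewrite /K; lra.
- by rewrite /u divr_gt0.
- rewrite /u mulrAC ler_pdivlMr // mulrA.
  have [h _] := par_s; apply: (le_trans h); rewrite ler_pM2l //.
  by have /andP[_ h2] := par_q; have := par_m'; lra.
- by rewrite /mu' mulr_ge0 ?exprn_ge0.
- by rewrite /mu /mu' ler_wpM2l // lerXn2r ?nnegrE // ltW.
- by rewrite /eta divr_ge0 ?exprn_ge0 // ltW.
- exact: par_eta.
Qed.

Let p01 : 0 <= p <= 1. Proof. by rewrite par_p1 ltW // par_p0. Qed.
Let mu0 : 0 < mu. Proof. exact: mu_gt0 par_setting. Qed.

Lemma par_max_degree :
  \sum_(G : sgraph n | [exists v, heavy G D v]) gnp p G <= 1 / 256.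
Proof.
apply: le_trans (@gnp_max_degree R n p D p01) _.
have [_ xy] := par_y; have x0 := par_x0; have n0 := par_n0R.
set y := (_ %/ _)%N in xy.
have h1 : (1 + p) ^+ n <= 4 ^+ (y + 2).
  apply: (@le_trans _ _ (expR p ^+ n)).
    by rewrite lerXn2r ?nnegrE ?expR_ge0 ?expR_ge1Dx // addr_ge0 // ltW // par_p0.
  rewrite -expRM_natl; apply: (@le_trans _ _ (expR 1 ^+ (y + 2))).
    by rewrite -expRM_natl mulr1 ler_expR natrD.
  by rewrite lerXn2r ?nnegrE ?expR_ge0 // expR1_le4.
have DE : D = ((y + 2) * 2 + (L + 8))%N by rewrite /D /degree_cap -/y; lia.
have e2 : 2 ^+ D = 4 ^+ (y + 2) * (2 ^+ L * 256) :> R.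
  rewrite DE exprD mulnC exprM (_ : 2 ^+ 2 = 4); last by ring.
  by congr (_ * _); rewrite exprD; congr (_ * _); ring.
have k0 : 0 < 4 ^+ (y + 2) :> R by rewrite exprn_gt0.
have L0 : 0 < 2 ^+ L :> R by rewrite exprn_gt0.
have nL' : n%:R <= 2 ^+ L :> R by rewrite -natrX ler_nat ltnW //; case/andP: nL.
rewrite e2 ler_pdivrMr; last by rewrite !mulr_gt0.
apply: (@le_trans _ _ (2 ^+ L * 4 ^+ (y + 2))).
  by apply: ler_pM => //; rewrite ?exprn_ge0 // addr_ge0 // ltW // par_p0.
by lra.
Qed.

Lemma gnp_markov (B : pred (sgraph n)) (f : sgraph n -> R) :
  (forall G, 0 <= f G) -> (forall G, B G -> 1 <= f G) ->
  \sum_(G | B G) gnp p G <= \sum_(G : sgraph n) gnp p G * f G.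
Proof.
move=> f0 fB; rewrite big_mkcond; apply: ler_sum => G _.
have g0 := gnp_ge0 G p01.
by case: ifP => [/fB fG|_]; [rewrite ler_peMr | rewrite mulr_ge0].
Qed.

(** At [e = 20] the upper edge is [11 mu] and the lower one is negative, so Markov's inequality
    suffices. Otherwise the variance is at most [mu (1 + 3 x p)], and the range condition makes
    [e ^ 2 mu] at least [4 * 11] times [1 + 3 x]. *)
Lemma par_window :
  \sum_(G : sgraph n | ~~ (mu * (1 - e / 2) <= (C3 G)%:R <= mu * (1 + e / 2)))
     gnp p G <= 1 / 11.
Proof.
have [big|small] := lerP 20 eps.
  have eE : e = 20 by apply/min_idPr.
  have m11 : 0 < 11 * mu by rewrite mulr_gt0.
  apply: (@le_trans _ _ (\sum_(G : sgraph n) gnp p G * ((C3 G)%:R / (11 * mu)))).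
    apply: gnp_markov => G; first by rewrite divr_ge0 // ltW.
    rewrite eE negb_and -!ltNge ler_pdivlMr // mul1r => /orP[] h; last by lra.
    by have : 0 <= (C3 G)%:R :> R by []; lra.
  under eq_bigr => G _ do rewrite mulrA.
  rewrite -mulr_suml Egnp_C3 -/mu ler_pdivrMr //; lra.
have eE : e = eps by apply/min_idPl; rewrite ltW.
have e0 := par_e0; have x0 := par_x0.
pose d := (e / 2 * mu) ^+ 2.
have d0 : 0 < d by rewrite exprn_gt0 // mulr_gt0 // divr_gt0.
apply: (@le_trans _ _ (\sum_(G : sgraph n) gnp p G * (((C3 G)%:R - mu) ^+ 2 / d))).
  apply: gnp_markov => G; first by rewrite divr_ge0 ?sqr_ge0 // ltW.
  move=> h; rewrite ler_pdivlMr // mul1r /d -[leRHS]real_normK ?num_real //.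
  rewrite lerXn2r ?nnegrE //; first by rewrite ltW // mulr_gt0 // divr_gt0.
  move: h; rewrite negb_and -!ltNge => /orP[] h.
    by rewrite distrC ler_normr; apply/orP; left; lra.
  by rewrite ler_normr; apply/orP; left; lra.
have -> : \sum_(G : sgraph n) gnp p G * (((C3 G)%:R - mu) ^+ 2 / d) =
  (\sum_(G : sgraph n) gnp p G * (C3 G)%:R ^+ 2 - mu ^+ 2) / d.
  transitivity ((\sum_(G : sgraph n) gnp p G * (C3 G)%:R ^+ 2
     - 2 * mu * (\sum_(G : sgraph n) gnp p G * (C3 G)%:R)
     + mu ^+ 2 * \sum_(G : sgraph n) gnp p G) / d).
    rewrite !mulr_sumr -sumrB -big_split mulr_suml; apply: eq_bigr => G _ /=.
    by ring.
  by rewrite Egnp_C3 gnp_sum1 -/mu; congr (_ / _); ring.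
rewrite ler_pdivrMr //.
have h1 := Egnp_C3_sq n p01; rewrite -/mu in h1.
have h2 : 'C(n, 3)%:R * (p ^+ 3 + 3 * n%:R * p ^+ 5) = mu * (1 + 3 * x * p).
  by rewrite /mu /x; ring.
rewrite h2 in h1.
have xp : x * p <= x by rewrite ler_piMr ?par_p1 // ltW.
have np := in_range_np rng; rewrite -/x -eE in np.
have ee : e ^+ 2 <= 400.
  by rewrite (_ : 400 = 20 ^+ 2); [rewrite lerXn2r ?nnegrE ?par_e20 // ltW | ring].
have x25 : 25 <= x.
  have : e ^+ 2 * x <= 400 * x by rewrite ler_wpM2r // ltW.
  by lra.
have h3 : 100 * 100 * x ^+ 2 <= 27 * (e ^+ 2 * mu).
  apply: (@le_trans _ _ (e ^+ 2 * x ^+ 3)).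
    by rewrite [x ^+ 3]exprS [leRHS]mulrA ler_wpM2r // exprn_ge0 // ltW.
  by rewrite [leRHS]mulrCA ler_wpM2l ?exprn_ge0 ?(ltW e0) // (ns_mu_ge par_setting).
have h4 : 44 * (1 + 3 * x) <= e ^+ 2 * mu.
  have : 25 * x <= x ^+ 2 by rewrite expr2 ler_wpM2r // ltW.
  by lra.
have h5 : mu * (44 * (1 + 3 * x)) <= mu * (e ^+ 2 * mu) by rewrite ler_pM2l.
have h6 : mu * (1 + 3 * x * p) <= mu * (1 + 3 * x) by rewrite ler_pM2l //; lra.
have -> : 1 / 11 * d = (mu * (e ^+ 2 * mu)) / 44 by rewrite /d; field.
by lra.
Qed.

Local Notation prob G b :=
  (rounds G D (fun b' => (b' == b)%:R : R) (accepts n P E D s) s 0).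

Lemma par_accept : 2 / 3 <= \sum_(G : sgraph n) gnp p G * prob G true.
Proof.
have n0 := par_n0; have D0 := par_D0.
have prob0 (G : sgraph n) : 0 <= prob G true.
  by apply: rounds_ge0 => b; rewrite ler0n.
pose win (G : sgraph n) := mu * (1 - e / 2) <= (C3 G)%:R <= mu * (1 + e / 2).
pose hv (G : sgraph n) := [exists v, heavy G D v].
have good G : ~~ hv G -> win G -> 99 / 100 <= prob G true.
  move=> nh wG; have := @rounds_out R n G D n0 D0 (accepts n P E D s) s 0.
  have [_ _ _ e20] := par_E.
  have := @prej_good R n G D par_n3 D0 P E s p e K eta par_setting par_small e20
    par_approx _ wG.
  have nh' v : ~~ heavy G D v.
    by apply: contra nh => hG; apply/existsP; exists v.
  by move=> /(_ nh') h1 h2; rewrite h2 in h1; lra.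
(* [99 / 100 * (1 - 1 / 256 - 1 / 11)] exceeds [2 / 3]. *)
apply: (@le_trans _ _ (99 / 100 * \sum_(G : sgraph n | ~~ hv G && win G) gnp p G)).
  have tot : \sum_(G : sgraph n) gnp p G <=
     \sum_(G : sgraph n | ~~ hv G && win G) gnp p G +
     (\sum_(G : sgraph n | hv G) gnp p G + \sum_(G : sgraph n | ~~ win G) gnp p G).
    rewrite big_mkcond [X in _ <= X + _]big_mkcond.
    rewrite [X in _ <= _ + (X + _)]big_mkcond [X in _ <= _ + (_ + X)]big_mkcond.
    rewrite -!big_split /=; apply: ler_sum => G _; have g0 := gnp_ge0 G p01.
    by case: (hv G); case: (win G); rewrite /= ?addr0 ?add0r // lerDl.
  rewrite gnp_sum1 in tot.
  have b1 := par_max_degree; have b2 := par_window; rewrite -/hv -/win in b1 b2.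
  by lra.
rewrite mulr_sumr big_mkcond; apply: ler_sum => G _; have g0 := gnp_ge0 G p01.
case: ifP => [/andP[h1 h2]|_]; last by rewrite mulr_ge0.
by rewrite mulrC ler_wpM2l // good.
Qed.

Lemma par_reject (G : sgraph n) : eps < `|rho_tri p G - 1| -> 2 / 3 <= prob G false.
Proof.
move=> bad; rewrite rounds_out ?par_n0 ?par_D0 //.
have C0 : 0 <= (C3 G)%:R :> R by [].
have e0 := par_eps0.
suff : prob G true <= 1 / 3 by lra.
have := @pacc_bad R n G D par_n3 par_D0 P E s p e K eta par_setting par_small
    par_approx.
apply.
rewrite -/mu; move: bad; rewrite /rho_tri Egnp_C3 -/mu ltr_normr => /orP[] bad.
  left; apply: (@le_lt_trans _ _ ((1 + eps) * mu)).
    by rewrite [leLHS]mulrC ler_pM2r // lerD2l ge_min lexx.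
  by rewrite -ltr_pdivlMr //; lra.
have lt : (C3 G)%:R < (1 - eps) * mu by rewrite -ltr_pdivrMr //; lra.
(* A count below the mean can be bad only for [eps < 1], where the cap at 20 has no effect. *)
have eps1 : eps < 1.
  rewrite ltNge; apply/negP => e1.
  have : (1 - eps) * mu <= 0 by rewrite mulr_le0_ge0 ?(ltW mu0) //; lra.
  by lra.
have eE : e = eps by apply/min_idPl; lra.
by right; rewrite eE mulrC.
Qed.

Lemma par_time :
  (3 * L + 28 * s + 64)%N%:R <= 60 * 1000 * K * p^-1 * (1 + ln n%:R + eps^-1) ^+ 4 :> R.
Proof.
have n0 := par_n0R; have p0 := par_p0; have p1 := par_p1; have x0 := par_x0.
have e0 := par_e0; have eps0 := par_eps0; have [_ Dle] := par_D.
have [_ sle] := par_s; have q1 := par_q1; have q0 : 0 < q by lra.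
set lam := 1 + ln n%:R + eps^-1.
have ln0 : 0 <= ln n%:R :> R by rewrite ln_ge0 // ler1n par_n0.
have ie0 : 0 < eps^-1 by rewrite invr_gt0.
have lam1 : 1 <= lam by rewrite /lam; lra.
have lam0 : 0 < lam by lra.
have Llam : L%:R <= 2 * lam.
  by have := @log2_le_ln R n L par_n0 (proj2 (andP nL)); rewrite /lam; lra.
have ielam : 1 <= lam * e.
  have [big|small] := lerP 20 eps.
    have -> : e = 20 by apply/min_idPr.
    by lra.
  have -> : e = eps by apply/min_idPl; rewrite ltW.
  rewrite /lam mulrDl mulVf ?gt_eqF // lerDr mulr_ge0 ?(ltW eps0) //; lra.
have K1 : 1 <= K by rewrite /K; lra.
have ip1 : 1 <= p^-1 by rewrite invf_ge1.
have ip0 : 0 < p^-1 by lra.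
have lam14 : lam <= lam ^+ 4 by rewrite -[leLHS]expr1 ler_weXn2l.
have lam4 : 1 <= lam ^+ 4 by rewrite exprn_ege1.
have mq : 1 <= x -> e ^+ 2 * x ^+ 3 / 8 <= q.
  move=> x1; have x31 : 1 <= x ^+ 3 by rewrite exprn_ege1.
  have m1 : 1 <= m.
    rewrite leNgt; apply/negP => m1; have eE := par_small m1.
    by move: m1; rewrite /m eE; lra.
  have [_ a2] := par_approx m1; have a3 := par_approx3 m1; have et := par_eta.
  have et0 : 0 <= eta by rewrite /eta divr_ge0 // exprn_ge0 // ltW.
  have e20 := par_e20.
  have p30 : 0 <= p ^+ 3 by rewrite exprn_ge0 // ltW.
  have p3 : p ^+ 3 / 2 <= p' ^+ 3.
    apply: le_trans a3; rewrite mulrC ler_wpM2r //; lra.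
  have ee : (e / 2) ^+ 2 <= e' ^+ 2.
    have [e'0 _ _ _] := par_E.
    by rewrite lerXn2r ?nnegrE ?divr_ge0 ?(ltW e0) //; lra.
  have /andP[mq _] := par_q; apply: le_trans mq.
  rewrite /m' /x (exprMn 3 n%:R p') (exprMn 3 n%:R p).
  have -> : e ^+ 2 * (n%:R ^+ 3 * p ^+ 3) / 8 =
    (e / 2) ^+ 2 * (n%:R ^+ 3 * (p ^+ 3 / 2)) by field.
  apply: ler_pM; rewrite ?sqr_ge0 //.
    by apply: mulr_ge0; [apply: exprn_ge0; exact: ltW | exact: divr_ge0].
  by rewrite ler_wpM2l // exprn_ge0 // ltW.
have main : K * n%:R * D%:R ^+ 2 / q <= 8 * 16 ^+ 2 * K * (p^-1 * lam ^+ 4).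
  have hD : D%:R <= 2 * x + 14 * lam by lra.
  have K0 : 0 < K by lra.
  exact: (samples_le K0 n0 p0 (ler0n _ _) hD lam1 ielam q1 mq).
rewrite time_natr.
have one : 1 <= p^-1 * lam ^+ 4 by rewrite -[1]mulr1; apply: ler_pM.
have lamb : lam <= p^-1 * lam ^+ 4.
  by apply: (le_trans lam14); rewrite ler_peMl // ltW // exprn_gt0.
have Kb : p^-1 * lam ^+ 4 <= K * (p^-1 * lam ^+ 4) by rewrite ler_peMl //; lra.
rewrite -[leRHS]mulrA -[60 * 1000 * K * _]mulrA.
clear mq; move: (p^-1 * lam ^+ 4) one lamb Kb main => V one lamb Kb main.
by lra.
Qed.

End Choices.

(** Each graph yields its own [L]; uniqueness allows the same parameters for all graphs. *)
Lemma pow2_window_uniq n L L' : (n < 2 ^ L <= 2 * n)%N -> (n < 2 ^ L' <= 2 * n)%N -> L = L'.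
Proof.
have half i j : (2 ^ i <= 2 * n)%N -> (n < 2 ^ j)%N -> (i <= j)%N.
  move=> hi hj; rewrite -ltnS -(ltn_exp2l _ _ (isT : 1 < 2)%N) expnS.
  by apply: leq_ltn_trans hi _; rewrite ltn_mul2l.
move=> /andP[a b] /andP[a' b']; apply/eqP.
by rewrite eqn_leq (half _ _ b a') (half _ _ b' a).
Qed.

Theorem theoremA1 (R : realType) :
  exists C0 : R, 0 < C0 /\
  (exists (prog : seq cmd) (K f : nat) (C : R) (k : nat),
     forall (n : nat) (p eps : R),
       in_range C0 n p eps ->
       qc_problem (@gnp R n p) (@rho_tri R n p) eps ->
       let A := ram_alg prog K f n p eps in
       let bound := C * p^-1 * (1 + ln n%:R + eps^-1) ^+ k in
       qc_solved_by (@gnp R n p) (@rho_tri R n p) eps (@out_prob R n A) /\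
       (forall G : sgraph n,
          (exp_queries R A G <= bound%:E)%E /\
          (exp_time R A G <= bound%:E)%E)) /\
  (forall E : R, exists c : R, 0 < c /\
     forall (n : nat) (p eps : R),
       in_range C0 n p eps ->
       eps <= E ->
       qc_problem (@gnp R n p) (@rho_tri R n p) eps ->
       (exists G : sgraph n, eps < `|rho_tri p G - 1|) ->
       forall A : qalg n,
         qc_solved_by (@gnp R n p) (@rho_tri R n p) eps (@out_prob R n A) ->
         exists G : sgraph n, ((c * p^-1)%:E <= exp_queries R A G)%E).
Proof.
have C00 : 0 < 100 * 100 :> R by rewrite mulr_gt0.
(* This value serves the upper bound; the lower bound holds for any positive one. *)
exists (100 * 100); split=> //; split; last first.
  move=> E; have [c [c0 h]] := quality_control_lower_bound E C00.
  by exists c; split=> // n p eps rng eE _; apply: h.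
exists triangle_prog, word_exp, 16%N, (60 * 1000 * (32 * 32 * (32 * 32))), 4%N.
move=> n p eps rng _ A bound.
have [n3 _ _ _] := rng; set M0 := (qinit A).2.
have M00 : M0 0 = n.
  rewrite /M0 /= modn_small // -[ltnLHS]expn1 ltn_exp2l //; exact: leq_trans n3.
have M0i i : (2 < i)%N -> M0 i = 0%N by case: i => [|[|[|i]]].
have Ple := (par_P rng).2.
have Ele : (fixpt n (n ^ word_exp) 16 eps <= n ^ word_exp)%N.
  exact: leq_trans (geq_minl _ _) (leq_pred _).
have run (G : sgraph n) := @triangle_prog_computes R n G (triangle_prog, M0)
  (fixpt n (n ^ word_exp) 16 p) (fixpt n (n ^ word_exp) 16 eps) M0 n3 M00 erefl erefl
  M0i Ple Ele.
(* Any graph provides [L]; the empty one is taken. *)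
have [L [nL _]] := run (sym_graph (fun _ _ => false)).
pose D := degree_cap n (fixpt n (n ^ word_exp) 16 p) L.
pose E := cap20 n (fixpt n (n ^ word_exp) 16 eps).
pose s := num_samples n (fixpt n (n ^ word_exp) 16 p) E D.
pose pr (G : sgraph n) b := rounds G D (fun b' => (b' == b)%:R : R)
  (accepts n (fixpt n (n ^ word_exp) 16 p) E D s) s 0.
have runL (G : sgraph n) (phi : bool -> R) : computes (n ^ word_exp) G (triangle_prog, M0) phi
    (3 * L + 28 * s + 64) (triangle_prog, M0)
    (rounds G D phi (accepts n (fixpt n (n ^ word_exp) 16 p) E D s) s 0).
  have [L' [nL' h]] := run G.
  by rewrite /s /D (pow2_window_uniq nL nL'); apply: h.
have outE (G : sgraph n) b : out_prob R A G b = pr G b.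
  exact: out_prob_computes (runL G _).
split.
  split; last by move=> G bad; rewrite outE; exact: (par_reject rng L bad).
  by under eq_bigr => G _ do rewrite outE; exact: (par_accept rng nL).
move=> G.
have time : (exp_time R A G <= bound%:E)%E.
  apply: le_trans (exp_time_computes (runL G (fun=> 0))) _.
  by rewrite lee_fin; exact: (par_time rng nL).
by split=> //; apply: le_trans time; exact: exp_queries_le_time.
Qed.
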